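(* Let $G$ be a non-compact locally compact Polish group. Then $G$ acts continuously by affine transformations on a separable Hilbert space such that all orbits are unbounded.
   Context: A Polish group is a separable, completely metrisable topological group. An action is continuous if the map $G\times \mathcal H\to \mathcal H$ is jointly continuous. Affine transformations of a Hilbert space $\mathcal H$ are here the maps $x\mapsto Tx+b$ with $T$ a bounded linear automorphism of $\mathcal H$ and $b\in \mathcal H$ (not necessarily isometric). *)

(* Defs.v *)
From HB Require Import structures.
From mathcomp Require Import all_boot all_order all_algebra.
From mathcomp Require Import all_classical all_reals all_analysis.

Set Implicit Arguments.
Unset Strict Implicit.
Unset Printing Implicit Defensive.

Import Order.TTheory GRing.Theory Num.Theory.
Import numFieldNormedType.Exports.

Local Open Scope classical_set_scope.
Local Open Scope ring_scope.

(* Multiplicative, not necessarily commutative, counterpart of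
   [topologicalZmodType]. *)
HB.structure Definition PreTopologicalGroup :=
  {G of Topological G & Group G}.

HB.mixin Record PreTopologicalGroup_isTopologicalGroup G
    & PreTopologicalGroup G := {
  mulg_continuous : continuous (fun x : G * G => (x.1 * x.2)%g) ;
  invg_continuous : continuous (fun x : G => (x^-1)%g) ;
}.

#[short(type="topologicalGroupType")]
HB.structure Definition TopologicalGroup :=
  {G of PreTopologicalGroup G & PreTopologicalGroup_isTopologicalGroup G}.

Definition separable_space (T : topologicalType) : Prop :=
  exists2 D : set T, countable D & dense D.

Definition complete_metric_space (R : realType) (M : metricType R) : Prop :=
  forall u : nat -> M, cauchy (u @ \oo) -> exists l : M, u @ \oo --> l.

Definition homeomorphic (S T : topologicalType) : Prop :=
  exists (f : S -> T) (g : T -> S),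
    [/\ continuous f, continuous g, cancel f g & cancel g f].

Definition completely_metrizable (R : realType) (T : topologicalType) : Prop :=
  exists2 M : metricType R, complete_metric_space M & homeomorphic T M.

Definition polish_space (R : realType) (T : topologicalType) : Prop :=
  separable_space T /\ completely_metrizable R T.

(* [{dot H for idfun}] is the type of positive definite symmetric bilinear
   forms on [H]; completeness is part of [completeNormedModType]. *)
Definition hilbert_space (R : realType) (H : completeNormedModType R) : Prop :=
  exists dot : {dot H for idfun}, forall x : H, `|x| ^+ 2 = dot x x.

Definition bounded_operator (R : realType) (H : normedModType R)
    (T : {linear H -> H}) : Prop :=
  exists M : R, forall x : H, `|T x| <= M * `|x|.

Definition affine_transformation (R : realType) (H : normedModType R)
    (f : H -> H) : Prop :=
  exists (T S : {linear H -> H}) (b : H),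
    [/\ bounded_operator T, bounded_operator S, cancel T S, cancel S T &
        forall x : H, f x = T x + b].

Definition left_action (G : groupType) (X : Type) (a : G -> X -> X) : Prop :=
  (forall x : X, a 1%g x = x) /\
  (forall (g h : G) (x : X), a (g * h)%g x = a g (a h x)).

(* Main.v *)
Require Import Defs.
From HB Require Import structures.
From mathcomp Require Import all_boot all_order all_algebra.
From mathcomp Require Import all_classical all_reals all_analysis.
From mathcomp Require Import ring lra.

Set Implicit Arguments.
Unset Strict Implicit.
Unset Printing Implicit Defensive.

Import Order.TTheory GRing.Theory Num.Theory.
Import numFieldNormedType.Exports.

Local Open Scope classical_set_scope.
Local Open Scope ring_scope.

(** The action lives on the dual of a weighted L^2 space of G, and the affine
hyperplane on which G acts is the set of functionals that take the value 1 at
the constant function 1.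

Call mean a positive linear functional M on the bounded continuous functions of
G with M 1 = 1. Write T_g f for the function x |-> f (g^-1 x), and suppose that
M (T_g f) <= C_g * M f for all f >= 0, with constants C_g that tend to 1 as g
tends to 1. Suppose moreover that there are compactly supported functions chi_n
with values in [0, 1] and M chi_n -> 1. Translations are then bounded for the
seminorm M (f^2)^(1/2), so G acts on the functionals psi that are bounded for
it, by psi |-> psi o T_(g^-1), and the affine hyperplane psi 1 = 1 is invariant.
This hyperplane contains M. Writing psi = M + phi, the functional phi kills the
constants, so it is bounded for the variance M (f^2) - (M f)^2; conversely every
functional bounded for the variance arises in this way. In terms of phi the
action is phi |-> phi o T_(g^-1) + (M o T_(g^-1) - M), which is an affine action
on a Hilbert space.

All its orbits are unbounded. If the orbit of phi were bounded by B, then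
|psi f| <= C * M ((T_g f)^2)^(1/2) would hold for all f and g, with a constant C
that depends only on B. Since G is not compact, some translate T_g f of a
compactly supported f is disjoint from the support of chi_m, whose complement
has mass at most 1 - M chi_m; so the right-hand side is arbitrarily small and
psi f = 0. Then psi chi_n = 0 for all n, whereas psi chi_n -> psi 1 = 1. This is [affine_act_unbounded].

The functionals are represented by their values on the functions T_g chi_n, and
so as functions on the index set G * nat. The ones that are bounded for the
variance form the reproducing kernel Hilbert space [rkhs] of the covariance
kernel. It is separable because the kernel is continuous in g.

The mean is M f = I (f * v) / I v, where I is a left Haar functional and v > 0
is an integrable continuous weight with v (g x) <= C_g * v x. The functional I
is obtained from Weil's covering numbers, by an ultralimit over bumps that shrink
to 1 ([exists_haar]); it is approximately additive by [covering_split]. For the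
weight ([exists_integrable_weight]), cover G by translates V s_n of a compact
neighbourhood V of 1 and give each letter n a large cost. The raw weight of x is
the supremum of the inverse costs of the words n_1 ... n_k such that x lies in
V s_(n_1) V s_(n_2) V ... s_(n_k) V. Multiplication by an element of V s_n
lengthens a word by the single letter n, so it divides the raw weight at most by
the cost of n. If F_n translates of V cover V s_n V, the set above is covered
by F_(n_1) ... F_(n_k) V, and the sum over all words of the inverse cost times
the number of translates is a convergent geometric series when the costs grow
fast enough. So the weight is integrable. *)

(** * Translations and uniform continuity on a topological group *)

Section GroupTranslations.
Context {G : topologicalGroupType}.
Implicit Types (g h x : G).

Lemma mulgr_continuous g : continuous (fun x => (x * g)%g).
Proof.
move=> x; apply: (cvg_comp (G := nbhs (x, g)) (fun y : G => (y, g))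
    (fun p : G * G => (p.1 * p.2)%g)); last exact: (@mulg_continuous G (x, g)).
by apply: (cvg_pair (f := id) (g := fun=> g)); [exact: cvg_id|exact: cvg_cst].
Qed.

Lemma mulgl_continuous g : continuous (fun x => (g * x)%g).
Proof.
move=> x; apply: (cvg_comp (G := nbhs (g, x)) (fun y : G => (g, y))
    (fun p : G * G => (p.1 * p.2)%g)); last exact: (@mulg_continuous G (g, x)).
by apply: (cvg_pair (f := fun=> g) (g := id)); [exact: cvg_cst|exact: cvg_id].
Qed.

Lemma near1_divr g (P : set G) :
  (\forall h \near (1%g : G), P h) -> \forall x \near g, P (x * g^-1)%g.
Proof.
move=> P1; have := @mulgr_continuous (g^-1)%g g.
by rewrite /continuous_at mulgV => /(_ _ P1).
Qed.

Lemma near1_inv (P : set G) :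
  (\forall h \near (1%g : G), P h) -> \forall h \near (1%g : G), P (h^-1)%g.
Proof.
move=> P1; have := @invg_continuous G 1%g.
by rewrite /continuous_at invg1 => /(_ _ P1).
Qed.

Lemma near1_conj g (P : set G) :
  (\forall h \near (1%g : G), P h) ->
  \forall h \near (1%g : G), P (g * h * g^-1)%g.
Proof.
move=> P1; have : (g * h * g^-1)%g @[h --> (1%g : G)] --> (g * 1 * g^-1)%g.
  apply: (@cvg_comp _ _ _ (fun h : G => (g * h)%g) (fun h => (h * g^-1)%g)).
    exact: mulgl_continuous.
  exact: mulgr_continuous.
by rewrite mulg1 mulgV => /(_ _ P1).
Qed.

End GroupTranslations.

Section Functions.
Context {R : realType} {G : topologicalGroupType}.
Implicit Types (f : G -> R) (g h x y : G) (t : R).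

Definition translate g f : G -> R := fun x => f (g^-1 * x)%g.

Definition bounded_continuous f :=
  continuous f /\ exists B : R, forall x, `|f x| <= B.

Definition left_uniformly_continuous f := forall e : R, 0 < e ->
  \forall h \near (1%g : G), forall y, `|translate h f y - f y| <= e.

Lemma translateM g h f : translate g (translate h f) = translate (g * h)%g f.
Proof. by apply/funext => x; rewrite /translate invgM mulgA. Qed.

Lemma translate1 f : translate 1%g f = f.
Proof. by apply/funext => x; rewrite /translate invg1 mul1g. Qed.

Lemma bc_cst t : bounded_continuous (fun=> t).
Proof. by split; [move=> x; exact: cvg_cst|exists `|t|]. Qed.

Lemma bcD f f' : bounded_continuous f -> bounded_continuous f' ->
  bounded_continuous (fun x => f x + f' x).
Proof.
move=> [fc [B fB]] [f'c [B' fB']]; split.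
  by move=> x; apply: cvgD; [exact: fc|exact: f'c].
by exists (B + B') => x; rewrite (le_trans (ler_normD _ _))// lerD.
Qed.

Lemma bcM f f' : bounded_continuous f -> bounded_continuous f' ->
  bounded_continuous (fun x => f x * f' x).
Proof.
move=> [fc [B fB]] [f'c [B' fB']]; split.
  by move=> x; apply: cvgM; [exact: fc|exact: f'c].
by exists (B * B') => x; rewrite normrM ler_pM.
Qed.

Lemma bcZ t f : bounded_continuous f -> bounded_continuous (fun x => t * f x).
Proof. by move=> fb; apply: bcM => //; exact: bc_cst. Qed.

Lemma bcB f f' : bounded_continuous f -> bounded_continuous f' ->
  bounded_continuous (fun x => f x - f' x).
Proof.
move=> fb f'b; rewrite (_ : (fun x => _) = fun x => f x + -1 * f' x).
  by apply: bcD => //; exact: bcZ.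
by apply/funext => x; rewrite mulN1r.
Qed.

Lemma bc_translate g f : bounded_continuous f -> bounded_continuous (translate g f).
Proof.
move=> [fc [B fB]]; split; last by exists B => x; exact: fB.
move=> x; apply: (@cvg_comp _ _ _ (fun y => (g^-1 * y)%g) f).
  exact: mulgl_continuous.
exact: fc.
Qed.

Lemma luc_cst t : left_uniformly_continuous (fun=> t).
Proof. by move=> e e0; near=> h => y; rewrite /translate subrr normr0 ltW.
Unshelve. all: by end_near. Qed.

Lemma lucD f f' : left_uniformly_continuous f -> left_uniformly_continuous f' ->
  left_uniformly_continuous (fun x => f x + f' x).
Proof.
move=> fu f'u e e0; have e20 : 0 < e / 2 by rewrite divr_gt0.
apply: filterS2 (fu _ e20) (f'u _ e20) => h h1 h2 y.
have := h1 y; have := h2 y; rewrite /translate !ler_norml.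
by move=> /andP[? ?] /andP[? ?]; apply/andP; split; lra.
Qed.

Lemma lucZ t f : left_uniformly_continuous f ->
  left_uniformly_continuous (fun x => t * f x).
Proof.
move=> fu e e0; have e20 : 0 < e / (`|t| + 1) by rewrite divr_gt0// ltr_wpDl.
apply: filterS (fu _ e20) => h h1 y.
rewrite /translate -mulrBr normrM.
have := h1 y; rewrite ler_pdivlMr ?ltr_wpDl// => h2.
by apply: le_trans h2; rewrite mulrC ler_wpM2l// lerDl.
Qed.

Lemma luc_translate g f : left_uniformly_continuous f ->
  left_uniformly_continuous (translate g f).
Proof.
move=> fu e e0; apply: filterS (near1_conj g^-1%g (fu e e0)) => h h1 y.
have := h1 (g^-1 * y)%g; rewrite /translate !invgM !invgK.
by rewrite !mulgA mulgK.
Qed.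

End Functions.

(** * Continuous functions with compact support *)

Lemma cvg_dist_near (R : realType) (T : Type) (F : set_system T)
    {FF : Filter F} (u : T -> R) (l e : R) :
  u @ F --> l -> 0 < e -> F [set t | `|l - u t| < e].
Proof. by move=> /cvgrPdist_lt ul e0; exact: ul. Qed.

Lemma cvg_ler (R : realType) (T : Type) (F : set_system T)
    {FF : ProperFilter F} (u : T -> R) (l M : R) :
  u @ F --> l -> F [set t | u t <= M] -> l <= M.
Proof.
move=> ul uM; rewrite -(cvg_lim (@Rhausdorff R) ul).
by apply: limr_le => //; apply/cvg_ex; exists l.
Qed.

Lemma maxr_continuous (R : realType) (c : R) :
  continuous (fun t : R => Num.max c t).
Proof.
by move=> t; apply: (@continuous_max R R (fun=> c) id t);
  [exact: cvg_cst|exact: cvg_id].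
Qed.

Lemma minr_continuous (R : realType) (c : R) :
  continuous (fun t : R => Num.min c t).
Proof.
by move=> t; apply: (@continuous_min R R (fun=> c) id t);
  [exact: cvg_cst|exact: cvg_id].
Qed.

Section CompactSupport.
Context {R : realType} {G : topologicalGroupType}.
Implicit Types (f : G -> R) (g h x y : G) (t : R) (A B : set G).

Definition compactly_supported f :=
  continuous f /\ exists2 A, compact A & forall x, ~ A x -> f x = 0.

Lemma compact_image2 (op : G * G -> G) A B : continuous op ->
  compact A -> compact B -> compact [set op (x, y) | x in A & y in B].
Proof.
move=> opc cA cB; rewrite (_ : [set _ | _ in _ & _ in _] = op @` (A `*` B)).
  apply: continuous_compact; last exact: compact_setX.
  exact: continuous_subspaceT.
apply/seteqP; split => [_ [x Ax [y By <-]]|_ [[x y] [Ax By] <-]].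
  by exists (x, y).
by exists x => //; exists y.
Qed.

Lemma compact_inv A : compact A -> compact [set (x^-1)%g | x in A].
Proof.
move=> cA; apply: continuous_compact => //.
exact/continuous_subspaceT/invg_continuous.
Qed.

Lemma compact_translate g A : compact A -> compact [set (g * x)%g | x in A].
Proof.
move=> cA; apply: continuous_compact => //.
exact/continuous_subspaceT/mulgl_continuous.
Qed.

Lemma compact_finite_translates A (U : set G) : compact A -> nbhs (1%g : G) U ->
  exists s : seq G, forall x, A x -> exists2 g, g \in s & U (g^-1 * x)%g.
Proof.
move=> cA U1.
(* Near the point [x], the one-term family [:: x] already covers; [F] is
the filter of the families that contain a given one, along which a compact set
is covered at once. *)
pose F : set_system (seq G) :=
  [set P | exists s0 : seq G, forall s : seq G, {subset s0 <= s} -> P s].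
have FF : Filter F.
  split; first by exists [::].
    move=> P Q [s hs] [t ht]; exists (s ++ t) => r st.
    by split; [apply: hs|apply: ht] => g gs; apply: st; rewrite mem_cat gs ?orbT.
  by move=> P Q PQ [s hs]; exists s => t st; exact/PQ/hs.
have /compact_near_coveringP/(_ _ F
  (fun s x => exists2 g, g \in s & U (g^-1 * x)%g) FF) := cA.
case=> [x Ax|s hs]; last by exists s => x Ax; exact: hs.
exists ([set y | U (x^-1 * y)%g], [set s : seq G | x \in s]); last first.
  by move=> [y s] [/= Uy xs]; exists x.
split; last by exists [:: x] => s; apply; rewrite mem_head.
have := @mulgl_continuous G (x^-1)%g x.
by rewrite /continuous_at mulVg => /(_ _ U1).
Qed.

Lemma cs_bc f : compactly_supported f -> bounded_continuous f.
Proof.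
move=> [fc [A cA f0]]; split => //.
have : compact (f @` A) by apply: continuous_compact => //; exact: continuous_subspaceT.
move=> /compact_bounded[B [_ hB]].
exists `|B + 1| => x; have [Ax|nAx] := pselect (A x).
  apply: le_trans (hB (B + 1) _ _ _) (ler_norm _); first by rewrite ltrDl.
  by exists x.
by rewrite f0// normr0.
Qed.

Lemma cs_uniformly_continuous f : compactly_supported f ->
  forall e : R, 0 < e ->
    \forall u \near (1%g : G), forall x, `|f (x * u)%g - f x| <= e.
Proof.
move=> [fc [A cA f0]] e e0.
have nearA : \forall u \near (1%g : G), forall x, A x -> `|f (x * u)%g - f x| <= e.
  have /compact_near_coveringP/(_ G (nbhs (1%g : G))
    (fun u x => `|f (x * u)%g - f x| <= e)) := cA; apply => x Ax.
  have e20 : 0 < e / 2 by rewrite divr_gt0.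
  have c1 : f (p.1 * p.2)%g @[p --> (x, 1%g : G)] --> f (x * 1)%g.
    apply: (@cvg_comp _ _ _ (fun p : G * G => (p.1 * p.2)%g) f); last exact: fc.
    exact: (@mulg_continuous G (x, 1%g)).
  have c2 : f p.1 @[p --> (x, 1%g : G)] --> f x.
    by apply: (cvg_comp (G := nbhs x) fst f); [exact: cvg_fst|exact: fc].
  have FF : Filter (nbhs (x, 1%g : G)) by exact: nbhs_filter.
  have n1 := cvg_dist_near (FF := FF) c1 e20.
  have n2 := cvg_dist_near (FF := FF) c2 e20.
  suff : nbhs (x, 1%g : G) [set p | `|f (p.1 * p.2)%g - f p.1| <= e] by [].
  apply: (@filterS2 _ _ FF _ _ _ _ n1 n2) => -[y u] /= h1 h2; rewrite mulg1 in h1.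
  have -> : f (y * u)%g - f y = - (f x - f (y * u)%g) + (f x - f y) by ring.
  apply: le_trans (ler_normD _ _) _; rewrite normrN; lra.
have nearA' := near1_inv nearA.
apply: filterS2 nearA nearA' => u h1 h2 x.
have [Ax|nAx] := pselect (A x); first exact: h1.
(* If only [x * u] lies in the support, start from it and move by [u^-1]. *)
have [Axu|nAxu] := pselect (A (x * u)%g).
  by have := h2 _ Axu; rewrite mulgK distrC.
by rewrite !f0// subrr normr0 ltW.
Qed.

(** Inversion exchanges left and right translations. *)
Lemma cs_luc f : compactly_supported f -> left_uniformly_continuous f.
Proof.
move=> [fc [A cA f0]] e e0.
have fi : compactly_supported (fun x => f x^-1%g).
  split.
    move=> x; apply: (@cvg_comp _ _ _ (fun x : G => (x^-1)%g) f); last exact: fc.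
    exact: invg_continuous.
  exists [set (x^-1)%g | x in A]; first exact: compact_inv.
  move=> x nAx; apply: f0 => Ax; apply: nAx.
  by exists (x^-1)%g => //; rewrite invgK.
apply: filterS (cs_uniformly_continuous fi e0) => h hh y.
by have := hh (y^-1)%g; rewrite invgM invgK.
Qed.

Lemma csM f f' : compactly_supported f -> continuous f' ->
  compactly_supported (fun x => f x * f' x).
Proof.
move=> [fc [A cA f0]] f'c; split.
  by move=> x; apply: cvgM; [exact: fc|exact: f'c].
by exists A => // x nAx; rewrite f0// mul0r.
Qed.

Lemma csZ t f : compactly_supported f -> compactly_supported (fun x => t * f x).
Proof.
move=> fcs; rewrite (_ : (fun x => _) = (fun x => f x * t)).
  by apply: csM => // x; exact: cvg_cst.
by apply/funext => x; rewrite mulrC.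
Qed.

Lemma csD f f' : compactly_supported f -> compactly_supported f' ->
  compactly_supported (fun x => f x + f' x).
Proof.
move=> [fc [A cA f0]] [f'c [B cB f'0]]; split.
  by move=> x; apply: cvgD; [exact: fc|exact: f'c].
exists (A `|` B); first exact: compactU.
by move=> x nAB; rewrite f0 ?f'0 ?addr0// => h; apply: nAB; [right|left].
Qed.

Lemma csB f f' : compactly_supported f -> compactly_supported f' ->
  compactly_supported (fun x => f x - f' x).
Proof.
move=> fc f'c; rewrite (_ : (fun x => _) = fun x => f x + -1 * f' x).
  by apply: csD => //; exact: csZ.
by apply/funext => x; rewrite mulN1r.
Qed.

Lemma cs0 : compactly_supported (fun=> 0).
Proof.
by split; [move=> x; exact: cvg_cst|exists set0 => //; exact: compact0].
Qed.

Lemma cs_sum (I : eqType) (s : seq I) (F : I -> G -> R) :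
  (forall i, i \in s -> compactly_supported (F i)) ->
  compactly_supported (fun x => \sum_(i <- s) F i x).
Proof.
elim: s => [|i s IH] h.
  by under eq_fun do rewrite big_nil; exact: cs0.
under eq_fun do rewrite big_cons.
apply: csD; first by apply: h; rewrite mem_head.
by apply: IH => j js; apply: h; rewrite inE js orbT.
Qed.

Lemma cs_translate g f : compactly_supported f ->
  compactly_supported (translate g f).
Proof.
move=> fcs; split.
  by have [] := bc_translate g (cs_bc fcs).
have [_ [A cA f0]] := fcs.
exists [set (g * x)%g | x in A]; first exact: compact_translate.
move=> x nAx; apply: f0 => Ax; apply: nAx.
by exists (g^-1 * x)%g => //; rewrite mulVKg.
Qed.

Lemma cs_comp (u : R -> R) f : continuous u -> u 0 = 0 ->
  compactly_supported f -> compactly_supported (fun x => u (f x)).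
Proof.
move=> uc u0 [fc [A cA f0]]; split.
  by move=> x; apply: (@cvg_comp _ _ _ f u); [exact: fc|exact: uc].
by exists A => // x nAx; rewrite f0.
Qed.

End CompactSupport.

Section Bumps.
Context {R : realType} {G : topologicalGroupType}.
Hypothesis polishG : polish_space R G.
Hypothesis lcG : locally_compact [set: G].
Implicit Types (A B : set G).

Lemma compact_nbhs1 : exists2 V : set G, compact V & nbhs (1%g : G) V.
Proof.
have [V V1 [cV _]] := lcG (I : setT (1%g : G)).
have {}V1 : nbhs (1%g : G) [set x | setT x -> V x] by exact: V1.
by exists V => //; apply: filterS V1 => x; exact.
Qed.

(** The metric of the Polish topology enters only through the distance
to 1, which makes bumps and a countable base of neighbourhoods of 1. *)
Lemma distance_to_1 : exists d : G -> R, [/\ continuous d,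
  forall x, 0 <= d x, d 1%g = 0 &
  forall U : set G, nbhs (1%g : G) U ->
    exists2 r : R, 0 < r & forall x, d x < r -> U x].
Proof.
have [_ [T _ [f [f' [fc f'c ff' f'f]]]]] := polishG.
exists (fun x => mdist (f 1%g) (f x)); split.
- move=> x; apply/cvgrPdist_lt => e e0.
  have fxe : nbhs x [set y | ball (f x) e (f y)].
    by have := fc x _ (nbhsx_ballx (f x) e e0).
  apply: filterS fxe => y /=.
  rewrite ballEmdist /= => h; apply: le_lt_trans h.
  have := metric_triangle (f 1%g) (f x) (f y).
  have := metric_triangle (f 1%g) (f y) (f x).
  by rewrite (metric_sym (f y) (f x)) ler_norml; lra.
- by move=> x; exact: mdist_ge0.
- exact: mdistxx.
move=> U U1.
have : nbhs (f 1%g) (f' @^-1` U).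
  by apply: f'c; rewrite ff'.
move=> /nbhs_ballP[r /= r0 hr]; exists r => // x xr.
rewrite -(ff' x); apply: hr; by rewrite ballEmdist.
Qed.

Lemma bump (U : set G) : nbhs (1%g : G) U -> exists f : G -> R,
  [/\ compactly_supported f, forall x, 0 <= f x <= 1, f 1%g = 1 &
      forall x, ~ U x -> f x = 0].
Proof.
move=> U1; have [d [dc d0 d1 dU]] := distance_to_1.
have [V cV V1] := compact_nbhs1.
have [r r0 hr] := dU _ (filterI U1 V1).
pose f x := Num.max 0 (1 - d x / r).
have f0 x : ~ (U `&` V) x -> f x = 0.
  move=> nUV; have : ~ d x < r by move=> /hr.
  move/negP; rewrite -leNgt => h.
  by apply/max_idPl; rewrite subr_le0 ler_pdivlMr// mul1r.
exists f; split.
- split; last by exists V => // x nV; apply: f0 => -[].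
  move=> x; apply: (cvg_comp (fun x => 1 - d x / r) (fun t => Num.max 0 t));
    last exact: maxr_continuous.
  apply: cvgB; first exact: cvg_cst.
  by apply: cvgM; [exact: dc|exact: cvg_cst].
- move=> x; rewrite /f le_max lexx /= ge_max ler01/=.
  by rewrite gerBl divr_ge0// ltW.
- by rewrite /f d1 mul0r subr0; apply/max_idPr.
- by move=> x nU; apply: f0 => -[].
Qed.

Lemma bump_sequence : exists f : nat -> G -> R, [/\
  forall n, compactly_supported (f n),
  forall n x, 0 <= f n x <= 1, forall n, f n 1%g = 1 &
  forall U : set G, nbhs (1%g : G) U ->
    \forall n \near \oo, forall x, ~ U x -> f n x = 0].
Proof.
have [d [dc d0 d1 dU]] := distance_to_1.
have nb n : nbhs (1%g : G) [set x | d x < (n.+1%:R : R)^-1].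
  have i0 : 0 < (n.+1%:R : R)^-1 by rewrite invr_gt0.
  apply: filterS (cvg_dist_near (dc 1%g) i0) => x /=.
  by rewrite d1 sub0r normrN ger0_norm.
have [f fP] := choice (fun n => bump (nb n)).
exists f; split=> [n|n|n|U U1]; first by have [] := fP n.
- by have [] := fP n.
- by have [] := fP n.
have [r r0 hr] := dU U U1.
near=> n => x nU; have [_ _ _] := fP n; apply => /= dx.
apply: nU; apply: hr; apply: lt_trans dx _.
by near: n; exact: near_infty_natSinv_lt (PosNum r0).
Unshelve. all: by end_near. Qed.

(** A finite sum of translates of a bump is at least 1/2 on the compact
set; doubling and truncating it at 1 gives the cutoff. *)
Lemma cutoff A : compact A -> exists f : G -> R,
  [/\ compactly_supported f, forall x, 0 <= f x <= 1 & forall x, A x -> f x = 1].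
Proof.
move=> cA; have [f [fcs f01 f1 _]] := bump (@filterT _ (nbhs (1%g : G)) _).
have U1 : nbhs (1%g : G) [set x | 1 / 2 < f x].
  have [fc _] := fcs; have h0 : 0 < 1 / 2 :> R by rewrite divr_gt0.
  apply: filterS (cvg_dist_near (fc 1%g) h0) => x /=.
  by rewrite f1 ltr_norml => /andP[_]; lra.
have [s hs] := compact_finite_translates cA U1.
pose F x := \sum_(g <- s) translate g f x.
have Fcs : compactly_supported F by apply: cs_sum => g _; exact: cs_translate.
have F0 x : 0 <= F x by apply: sumr_ge0 => g _; have /andP[] := f01 (g^-1 * x)%g.
exists (fun x => Num.min 1 (2 * F x)); split.
- apply: (@cs_comp _ _ (fun t => Num.min 1 (2 * t))) => //.
    move=> t; apply: (cvg_comp (fun t : R => 2 * t) (fun t => Num.min 1 t));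
      last exact: minr_continuous.
    by apply: cvgM; [exact: cvg_cst|exact: cvg_id].
  by rewrite mulr0; apply/min_idPr.
- move=> x; rewrite le_min ler01 mulr_ge0//= ge_min lexx//.
move=> x Ax; apply/min_idPl.
have [g gs /= hg] := hs x Ax.
have : translate g f x <= F x.
  rewrite /F (big_rem g)//= lerDl; apply: sumr_ge0 => h _.
  by have /andP[] := f01 (h^-1 * x)%g.
by rewrite /translate; lra.
Qed.

End Bumps.

(** * Finite linear combinations *)

Section Combinations.
Context {R : realType} {X : Type}.
Implicit Types (f g : X -> R) (l m : seq (R * X)) (t : R).

(** A list of coefficients and points stands for a formal linear
combination of points, with repetitions allowed; [comb] is the linear extension
of a function to them. *)
Definition comb f l : R := \sum_(p <- l) p.1 * f p.2.

Definition scale_comb t l : seq (R * X) := [seq (t * p.1, p.2) | p <- l].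

Lemma comb_nil f : comb f [::] = 0. Proof. exact: big_nil. Qed.

Lemma comb1 f t x : comb f [:: (t, x)] = t * f x.
Proof. exact: big_seq1. Qed.

Lemma comb_cat f l m : comb f (l ++ m) = comb f l + comb f m.
Proof. exact: big_cat. Qed.

Lemma comb_scale f t l : comb f (scale_comb t l) = t * comb f l.
Proof.
rewrite /comb big_map mulr_sumr; apply: eq_bigr => p _; exact/esym/mulrA.
Qed.

Lemma combD f g l : comb (fun x => f x + g x) l = comb f l + comb g l.
Proof. by rewrite -big_split; apply: eq_bigr => p _; rewrite mulrDr. Qed.

Lemma combZ t f l : comb (fun x => t * f x) l = t * comb f l.
Proof. by rewrite mulr_sumr; apply: eq_bigr => p _; rewrite mulrCA. Qed.

Lemma combN f l : comb (fun x => - f x) l = - comb f l.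
Proof. by rewrite -mulN1r -combZ; apply: eq_bigr => p _; rewrite mulN1r. Qed.

Lemma combB f g l : comb (fun x => f x - g x) l = comb f l - comb g l.
Proof. by rewrite combD combN. Qed.

End Combinations.

Section NonnegativeCombinations.
Context {R : realType} {X : Type}.
Implicit Types (l : seq (R * X)) (F : X -> R).

Definition nonneg_comb l := all (fun p => 0 <= p.1) l.

Lemma comb_le l F F' : nonneg_comb l -> (forall x, F x <= F' x) ->
  comb F l <= comb F' l.
Proof.
move=> + FF'; elim: l => [|p l IH] /=; first by rewrite !comb_nil.
by move=> /andP[p0 l0]; rewrite /comb !big_cons lerD ?ler_wpM2l//; exact: IH.
Qed.

Lemma comb_ge0 l F : nonneg_comb l -> (forall x, 0 <= F x) -> 0 <= comb F l.
Proof.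
move=> l0 F0; apply: le_trans (comb_le l0 F0).
by rewrite /comb big1// => p _; rewrite mulr0.
Qed.

Definition weight l : R := comb (fun=> 1) l.

Lemma weight_ge0 l : nonneg_comb l -> 0 <= weight l.
Proof. by move=> l0; apply: comb_ge0. Qed.

End NonnegativeCombinations.

(** * Limits along a free ultrafilter *)

Section UltraLimit.
Context {R : realType}.

Definition bounded_seq (u : nat -> R) := exists B : R, forall n, `|u n| <= B.

Lemma free_ultrafilter :
  exists U : set_system nat, UltraFilter U /\ (\oo : set_system nat) `<=` U.
Proof. by have [U [? ?]] := @ultraFilterLemma _ (\oo : set_system nat) _; exists U. Qed.

Definition ultrafilter_nat : set_system nat := sval (cid free_ultrafilter).

Lemma ultrafilter_natP :
  UltraFilter ultrafilter_nat /\ (\oo : set_system nat) `<=` ultrafilter_nat.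
Proof. exact: svalP (cid free_ultrafilter). Qed.

Local Notation U := ultrafilter_nat.

#[local] Instance ultrafilter_nat_ultra : UltraFilter U.
Proof. by have [] := ultrafilter_natP. Qed.

Definition ulim (u : nat -> R) : R := lim (u @ U).

(** The image of an ultrafilter is an ultrafilter, and it converges as
soon as it contains a compact interval. *)
Lemma ulim_cvg u : bounded_seq u -> u @ U --> ulim u.
Proof.
move=> [B uB].
have Uu : UltraFilter (u @ U).
  split; first exact: fmap_proper_filter.
  move=> F FF uF; apply/seteqP; split=> // A FA.
  have [//|nA] := in_ultra_setVsetC (u @^-1` A) ultrafilter_nat_ultra.
  have FnA : F (~` A) by apply: uF.
  by have := @filterI _ _ FF _ _ FA FnA; rewrite setICr => /filter_not_empty.
have := @segment_compact R (- B) B.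
rewrite compact_ultra => /(_ (u @ U) Uu) [].
  by apply: filterS (@filterT _ U _) => n _; rewrite /= in_itv/= -ler_norml.
by move=> l [_ ul]; apply/cvg_ex; exists l.
Qed.

Lemma ulim_unique u (l : R) : u @ U --> l -> ulim u = l.
Proof. by move=> ul; apply: cvg_lim => //; exact: Rhausdorff. Qed.

Lemma ulim_cst (t : R) : ulim (fun=> t) = t.
Proof. by apply: ulim_unique; exact: cvg_cst. Qed.

Lemma ulimDZ (t : R) u v : bounded_seq u -> bounded_seq v ->
  ulim (fun n => t * u n + v n) = t * ulim u + ulim v.
Proof.
move=> ub vb; apply: ulim_unique; apply: cvgD; last exact: ulim_cvg.
by apply: cvgM; [exact: cvg_cst|exact: ulim_cvg].
Qed.

Lemma ulim_le u v : bounded_seq u -> bounded_seq v ->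
  (\forall n \near \oo, u n <= v n) -> ulim u <= ulim v.
Proof.
move=> ub vb uv; rewrite -subr_ge0 -oppr_le0.
have h : (fun n => - (v n - u n)) @ U --> - (ulim v - ulim u).
  by apply: cvgN; apply: cvgB; exact: ulim_cvg.
apply: (cvg_ler h); have [_ /(_ _ uv)] := ultrafilter_natP.
by apply: filterS => n; rewrite /= oppr_le0 subr_ge0.
Qed.

Lemma bounded_seqDZ (t : R) u v : bounded_seq u -> bounded_seq v ->
  bounded_seq (fun n => t * u n + v n).
Proof.
move=> [B uB] [C vC]; exists (`|t| * B + C) => n.
by rewrite (le_trans (ler_normD _ _))// lerD// normrM ler_wpM2l.
Qed.

End UltraLimit.

(** * A left Haar functional, by covering numbers *)

Section CoveringNumbers.
Context {R : realType} {G : topologicalGroupType}.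
Implicit Types (f phi : G -> R) (g x : G) (l : seq (R * G)) (t : R).

Definition majorizes phi l f := nonneg_comb l /\
  forall x, f x <= comb (fun g => translate g phi x) l.

(** Weil's covering number (f : phi): the least total mass of a
nonnegative combination of translates of [phi] that dominates [f]. *)
Definition covering phi f : R := inf [set weight l | l in [set l | majorizes phi l f]].

Definition positive_cs f := compactly_supported f /\ forall x, 0 <= f x.

Variable phi : G -> R.
Hypothesis phi_cs : positive_cs phi.
Hypothesis phi1 : 0 < phi 1%g.

Lemma exists_majorant f : compactly_supported f -> exists l, majorizes phi l f.
Proof.
move=> fcs; have [_ [A cA f0]] := fcs; have [_ [B fB]] := cs_bc fcs.
have B0 : 0 <= B by exact: le_trans (fB 1%g).
have [[phic _] phi0] := phi_cs.
have p20 : 0 < phi 1%g / 2 by rewrite divr_gt0.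
have U1 : nbhs (1%g : G) [set x | phi 1%g / 2 < phi x].
  apply: filterS (cvg_dist_near (phic 1%g) p20) => x /=.
  by rewrite ltr_norml => /andP[_]; lra.
have [s hs] := compact_finite_translates cA U1.
pose c := B / (phi 1%g / 2).
have c0 : 0 <= c by rewrite divr_ge0// ltW.
exists [seq (c, g) | g <- s].
have l0 : nonneg_comb [seq (c, g) | g <- s].
  by apply/allP => _ /mapP[g _ ->].
split=> // x; have [Ax|nAx] := pselect (A x); last first.
  by rewrite f0//; apply: comb_ge0 => // g; exact: phi0.
have [g gs /= hg] := hs x Ax.
rewrite /comb big_map (big_rem g)//=.
apply: (@le_trans _ _ (c * translate g phi x)); last first.
  by rewrite lerDl; apply: sumr_ge0 => h _; rewrite mulr_ge0//; exact: phi0.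
apply: le_trans (ler_norm _) _; apply: le_trans (fB x) _.
by rewrite /c mulrAC ler_pdivlMr// ler_wpM2l// ltW.
Qed.

Lemma covering_has_inf f : compactly_supported f ->
  has_inf [set weight l | l in [set l | majorizes phi l f]].
Proof.
move=> fcs; split.
  by have [l hl] := exists_majorant fcs; exists (weight l), l.
by exists 0 => _ [l [l0 _] <-]; exact: weight_ge0.
Qed.

Lemma covering_le f l : majorizes phi l f -> covering phi f <= weight l.
Proof.
move=> fl; apply: ge_inf; last by exists l.
by exists 0 => _ [m [m0 _] <-]; exact: weight_ge0.
Qed.

Lemma covering_ge f c : compactly_supported f ->
  (forall l, majorizes phi l f -> c <= weight l) -> c <= covering phi f.
Proof.
move=> fcs h; apply: lb_le_inf; first by have [] := covering_has_inf fcs.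
by move=> _ [l lf <-]; exact: h.
Qed.

Lemma covering_ge0 f : compactly_supported f -> 0 <= covering phi f.
Proof. by move=> fcs; apply: covering_ge => // l [l0 _]; exact: weight_ge0. Qed.

Lemma covering_mono f f' : compactly_supported f' ->
  (forall x, f x <= f' x) -> covering phi f <= covering phi f'.
Proof.
move=> fcs ff'; apply: covering_ge => // l [l0 fl]; apply: covering_le.
by split=> // x; apply: le_trans (fl x).
Qed.

Lemma coveringD f f' : compactly_supported f -> compactly_supported f' ->
  covering phi (fun x => f x + f' x) <= covering phi f + covering phi f'.
Proof.
move=> fcs fcs'; rewrite -lerBlDr; apply: covering_ge => // l [l0 fl].
rewrite lerBlDr addrC -lerBlDr; apply: covering_ge => // m [m0 fm].
rewrite lerBlDr /weight -comb_cat; apply: covering_le; split.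
  by rewrite /nonneg_comb all_cat; apply/andP; split.
by move=> x; rewrite comb_cat addrC lerD.
Qed.

Lemma coveringZ_le t f : 0 <= t -> compactly_supported f ->
  covering phi (fun x => t * f x) <= t * covering phi f.
Proof.
move=> t0 fcs.
have h l : majorizes phi l f -> covering phi (fun x => t * f x) <= t * weight l.
  move=> [l0 fl]; rewrite /weight -comb_scale; apply: covering_le; split.
    rewrite /nonneg_comb all_map; apply: sub_all l0 => p p0 /=; exact: mulr_ge0.
  by move=> x; rewrite comb_scale ler_wpM2l.
have [t_eq0|tn0] := eqVneq t 0.
  have [l hl] := exists_majorant fcs; have := h l hl.
  by rewrite t_eq0 !mul0r.
have tgt0 : 0 < t by rewrite lt_neqAle eq_sym tn0.
rewrite -ler_pdivrMl//; apply: covering_ge => // l hl.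
by rewrite ler_pdivrMl//; exact: h.
Qed.

Lemma coveringZ t f : 0 < t -> compactly_supported f ->
  covering phi (fun x => t * f x) = t * covering phi f.
Proof.
move=> t0 fcs; apply/eqP; rewrite eq_le (coveringZ_le (ltW t0) fcs) /=.
rewrite -ler_pdivlMl//.
have ti0 : 0 <= t^-1 by rewrite invr_ge0 ltW.
have := coveringZ_le ti0 (csZ t fcs).
rewrite (_ : (fun x => _) = f)//; apply/funext => x.
by rewrite mulrA mulVf ?mul1r// gt_eqF.
Qed.

Lemma covering_translate_le g f : compactly_supported f ->
  covering phi (translate g f) <= covering phi f.
Proof.
move=> fcs; apply: covering_ge => // l [l0 fl].
have -> : weight l = weight [seq (p.1, (g * p.2)%g) | p <- l].
  by rewrite /weight /comb big_map.
apply: covering_le; split; first by rewrite /nonneg_comb all_map; apply: sub_all l0.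
move=> x; apply: le_trans (fl _) _; rewrite /comb big_map le_eqVlt.
apply/orP; left; apply/eqP; apply: eq_bigr => p _ /=.
by rewrite /translate invgM mulgA.
Qed.

Lemma covering_translate g f : compactly_supported f ->
  covering phi (translate g f) = covering phi f.
Proof.
move=> fcs; apply/eqP; rewrite eq_le covering_translate_le//=.
have := covering_translate_le g^-1%g (cs_translate g fcs).
by rewrite translateM mulVg translate1.
Qed.

(** Substituting a covering of [psi] by translates of [phi] into a
covering of [f] by translates of [psi]. With [psi] a fixed reference function,
it bounds (f : phi) / (psi : phi) by a constant that does not depend on [phi]. *)
Lemma covering_weight_le psi f l : positive_cs psi -> majorizes psi l f ->
  covering phi f <= weight l * covering phi psi.
Proof.
move=> [psics psi0] [l0 fl].
have scs m : compactly_supported (fun x => comb (fun g => translate g psi x) m).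
  elim: m => [|p m IH].
    rewrite (_ : (fun x => _) = fun=> 0); first exact: cs0.
    by apply/funext => x; exact: comb_nil.
  rewrite (_ : (fun x => _) = fun x => p.1 * translate p.2 psi x
    + comb (fun g => translate g psi x) m); last first.
    by apply/funext => x; exact: big_cons.
  by apply: csD => //; apply: csZ; exact: cs_translate.
apply: le_trans (covering_mono (scs l) fl) _.
elim: l l0 {fl} => [_|p l IH /= /andP[p0 l0]].
  rewrite /weight comb_nil mul0r; apply: (@le_trans _ _ (weight [::])).
    by apply: covering_le; split=> // x; rewrite !comb_nil.
  by rewrite /weight comb_nil.
rewrite (_ : (fun x => comb _ (p :: l)) = fun x => p.1 * translate p.2 psi x
    + comb (fun g => translate g psi x) l); last first.
  by apply/funext => x; exact: big_cons.
have tcs := cs_translate p.2 psics.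
apply: le_trans (coveringD (csZ p.1 tcs) (scs l)) _.
rewrite [weight (p :: l)]big_cons mulr1 mulrDl lerD ?IH//.
by apply: le_trans (coveringZ_le p0 tcs) _; rewrite covering_translate.
Qed.

Lemma covering_ge1 f : (forall x, phi x <= 1) -> f 1%g = 1 ->
  compactly_supported f -> 1 <= covering phi f.
Proof.
move=> phile f1 fcs; apply: covering_ge => // l [l0 fl].
by rewrite -f1; apply: le_trans (fl 1%g) _; apply: comb_le => // g; exact: phile.
Qed.

(** Approximate additivity. Think of [h1] and [h2] as f1 / (f1 + f2) and
f2 / (f1 + f2). In a covering of f1 + f2 by translates of a function with small
support, [h1] and [h2] are almost constant on the support of each translate, so
the term at [g] can be split in the proportions h1 g and h2 g; since h1 + h2 <= 1
this costs only the oscillation [e]. The error term [e * f'] leaves room for a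
denominator that does not vanish. *)
Lemma covering_split f1 f2 f' h1 h2 (e : R) (U : set G) :
    compactly_supported f1 -> compactly_supported f2 ->
    compactly_supported f' -> 0 < e ->
    (forall x, 0 <= h1 x /\ 0 <= h2 x) -> (forall x, h1 x + h2 x <= 1) ->
    (forall x, f1 x <= h1 x * (f1 x + f2 x) + e * f' x) ->
    (forall x, f2 x <= h2 x * (f1 x + f2 x) + e * f' x) ->
    (forall x, ~ U x -> phi x = 0) ->
    (forall u x, U u -> `|h1 (x * u)%g - h1 x| <= e) ->
    (forall u x, U u -> `|h2 (x * u)%g - h2 x| <= e) ->
  covering phi f1 + covering phi f2 <=
    (1 + 2 * e) * covering phi (fun x => f1 x + f2 x) + 2 * e * covering phi f'.
Proof.
move=> f1cs f2cs f'cs e0 h0 hle1 f1h f2h phiU h1U h2U.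
have phi0 := phi_cs.2.
have key f h l : compactly_supported f -> (forall x, 0 <= h x) ->
    (forall x, f x <= h x * (f1 x + f2 x) + e * f' x) ->
    (forall u x, U u -> `|h (x * u)%g - h x| <= e) ->
    majorizes phi l (fun x => f1 x + f2 x) ->
    covering phi f <= comb (fun g => h g + e) l + e * covering phi f'.
  move=> fcs hx0 fh hU [l0 fl].
  pose l' := [seq (p.1 * (h p.2 + e), p.2) | p <- l].
  have l'E : comb (fun g => h g + e) l = weight l'.
    by rewrite /weight /comb big_map; apply: eq_bigr => p _; rewrite mulr1.
  have l'0 : nonneg_comb l'.
    rewrite /nonneg_comb all_map; apply: sub_all l0 => p p0 /=.
    by rewrite mulr_ge0// addr_ge0// ltW.
  rewrite l'E.
  have fhx x : f x - e * f' x <= comb (fun g => translate g phi x) l'.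
    rewrite lerBlDr; apply: le_trans (fh x) _; rewrite lerD2r.
    apply: le_trans (ler_wpM2l (hx0 x) (fl x)) _.
    rewrite -combZ /comb [leRHS]big_map big_seq [leRHS]big_seq.
    apply: ler_sum => p pl; have p0 : 0 <= p.1 := allP l0 p pl.
    rewrite /= -mulrA ler_wpM2l//.
    have [pU|/phiU] := pselect (U (p.2^-1 * x)%g); last first.
      by rewrite /translate => ->; rewrite !mulr0.
    rewrite ler_wpM2r//; first exact: phi0.
    have := hU _ p.2 pU; rewrite mulVKg ler_norml => /andP[_]; lra.
  have := coveringD (csB fcs (csZ e f'cs)) (csZ e f'cs).
  rewrite (_ : (fun x => _ + _) = f); last by apply/funext => x; rewrite subrK.
  move=> h3; apply: le_trans h3 _; apply: lerD; first exact: covering_le.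
  by apply: coveringZ_le => //; exact: ltW.
have e21 : 0 < 1 + 2 * e by rewrite addr_gt0// mulr_gt0.
rewrite -lerBlDr -ler_pdivrMl//; apply: covering_ge; first exact: csD.
move=> l fl; rewrite ler_pdivrMl// lerBlDr.
have h1x x : 0 <= h1 x by have [] := h0 x.
have h2x x : 0 <= h2 x by have [] := h0 x.
have := key _ _ _ f1cs h1x f1h h1U fl; have := key _ _ _ f2cs h2x f2h h2U fl.
have : comb (fun g => h1 g + e) l + comb (fun g => h2 g + e) l <=
    (1 + 2 * e) * weight l.
  rewrite -combD /weight -combZ; apply: comb_le; first by have [] := fl.
  by move=> g; have := hle1 g; lra.
lra.
Qed.

End CoveringNumbers.

Record haar_functional (R : realType) (G : topologicalGroupType) := Haar {
  haar :> (G -> R) -> R ;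
  haarDZ : forall t f f', compactly_supported f -> compactly_supported f' ->
    haar (fun x => t * f x + f' x) = t * haar f + haar f' ;
  haar_ge0 : forall f, positive_cs f -> 0 <= haar f ;
  haar_translate : forall g f, compactly_supported f ->
    haar (translate g f) = haar f ;
  haar_neq0 : exists2 f, positive_cs f & 0 < haar f }.

Section PositiveCone.
Context {R : realType} {G : topologicalGroupType}.
Implicit Types (f p q : G -> R) (t : R).

Lemma positive_csD f f' : positive_cs f -> positive_cs f' ->
  positive_cs (fun x => f x + f' x).
Proof.
move=> [fcs f0] [fcs' f0']; split; first exact: csD.
by move=> x; rewrite addr_ge0.
Qed.

Lemma positive_csZ t f : 0 <= t -> positive_cs f -> positive_cs (fun x => t * f x).
Proof.
move=> t0 [fcs f0]; split; first exact: csZ.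
by move=> x; rewrite mulr_ge0.
Qed.

Variable C : (G -> R) -> R.
Hypothesis CD : forall f f', positive_cs f -> positive_cs f' ->
  C (fun x => f x + f' x) = C f + C f'.
Hypothesis CZ : forall t f, 0 <= t -> positive_cs f ->
  C (fun x => t * f x) = t * C f.

Definition positive_part f : G -> R := fun x => Num.max 0 (f x).
Definition negative_part f : G -> R := fun x => Num.max 0 (- f x).
Definition extension f := C (positive_part f) - C (negative_part f).

Lemma positive_part_cs f : compactly_supported f -> positive_cs (positive_part f).
Proof.
move=> fcs; split; last by move=> x; rewrite le_max lexx.
apply: (cs_comp (u := Num.max 0)) => //; first exact: maxr_continuous.
exact: maxxx.
Qed.

Lemma negative_part_cs f : compactly_supported f -> positive_cs (negative_part f).
Proof.
move=> fcs; rewrite (_ : negative_part f = positive_part (fun x => -1 * f x)).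
  exact/positive_part_cs/csZ.
by apply/funext => x; rewrite /negative_part /positive_part mulN1r.
Qed.

Lemma partsE f x : f x = positive_part f x - negative_part f x.
Proof. by rewrite /positive_part /negative_part !maxEle; case: ifP; case: ifP; lra. Qed.

(** The value does not depend on how the function is written as a
difference of nonnegative functions; linearity follows. *)
Lemma extensionE f p q : compactly_supported f -> positive_cs p ->
  positive_cs q -> (forall x, f x = p x - q x) -> extension f = C p - C q.
Proof.
move=> fcs pcs qcs fpq.
have fp := positive_part_cs fcs; have fn := negative_part_cs fcs.
have : C (fun x => positive_part f x + q x) = C (fun x => p x + negative_part f x).
  by congr C; apply/funext => x; have := fpq x; rewrite [f x]partsE; lra.
by rewrite !CD// /extension; lra.
Qed.

Lemma extension_positive f : positive_cs f -> extension f = C f.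
Proof.
move=> fcs; have z : positive_cs (fun x => 0 * f x) by exact: positive_csZ.
rewrite (extensionE fcs.1 fcs z) ?CZ// ?mul0r ?subr0//.
by move=> x; rewrite mul0r subr0.
Qed.

Lemma extensionDZ t f f' : compactly_supported f -> compactly_supported f' ->
  extension (fun x => t * f x + f' x) = t * extension f + extension f'.
Proof.
move=> fcs fcs'.
have fp := positive_part_cs fcs; have fn := negative_part_cs fcs.
have fp' := positive_part_cs fcs'; have fn' := negative_part_cs fcs'.
have tcs : compactly_supported (fun x => t * f x + f' x).
  by apply: csD => //; exact: csZ.
have [t0|/ltW t0] := leP 0 t.
  rewrite (extensionE tcs (positive_csD (positive_csZ t0 fp) fp')
    (positive_csD (positive_csZ t0 fn) fn')).
    by rewrite !CD ?CZ//; try exact: positive_csZ; rewrite /extension; ring.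
  by move=> x; rewrite [f x]partsE [f' x]partsE; ring.
have nt0 : 0 <= - t by rewrite oppr_ge0.
rewrite (extensionE tcs (positive_csD (positive_csZ nt0 fn) fp')
  (positive_csD (positive_csZ nt0 fp) fn')).
  by rewrite !CD ?CZ//; try exact: positive_csZ; rewrite /extension; ring.
by move=> x; rewrite [f x]partsE [f' x]partsE; ring.
Qed.

End PositiveCone.

Section Haar.
Context {R : realType} {G : topologicalGroupType}.
Hypothesis polishG : polish_space R G.
Hypothesis lcG : locally_compact [set: G].

(** Normalised by the covering number of a reference bump, covering numbers are
bounded along a sequence of bumps that shrink to 1, so they have an ultralimit. It
inherits invariance, and [covering_split] makes it additive in the limit. *)
Theorem exists_haar : inhabited (haar_functional R G).
Proof.
have [phi [phics phi01 phi1 phiU]] := bump_sequence polishG lcG.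
have phip n : positive_cs (phi n).
  by split=> // x; have /andP[] := phi01 n x.
have phi1_gt0 n : 0 < phi n 1%g by rewrite phi1.
pose q f n := covering (phi n) f / covering (phi n) (phi 0%N).
have d1 n : 1 <= covering (phi n) (phi 0%N).
  by apply: covering_ge1 => // x; have /andP[] := phi01 n x.
have d0 n : 0 < covering (phi n) (phi 0%N) by exact: lt_le_trans (d1 n).
have q0 f n : positive_cs f -> 0 <= q f n.
  by move=> [fcs _]; rewrite /q divr_ge0 ?(ltW (d0 n))//; exact: covering_ge0.
have qb f : positive_cs f -> exists B : R, forall n, q f n <= B.
  move=> [fcs _]; have [l hl] := exists_majorant (phip 0%N) (phi1_gt0 0%N) fcs.
  exists (weight l) => n; rewrite /q ler_pdivrMr//.
  exact: covering_weight_le.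
have qbs f : positive_cs f -> bounded_seq (q f).
  by move=> fp; have [B hB] := qb f fp; exists B => n; rewrite ger0_norm// q0.
pose C f := ulim (q f).
have CZ t f : 0 <= t -> positive_cs f -> C (fun x => t * f x) = t * C f.
  move=> t0 fp; have := ulimDZ t (qbs f fp) (qbs f fp).
  have qE n : q (fun x => t * f x) n = t * q f n.
    rewrite /q mulrA; congr (_ / _); have [fcs _] := fp.
    have [t_eq0|tn0] := eqVneq t 0; last first.
      by apply: coveringZ => //; rewrite lt_neqAle eq_sym tn0.
    rewrite t_eq0 mul0r; apply/eqP; rewrite eq_le.
    rewrite covering_ge0 ?andbT//; last exact: csZ.
    by have := coveringZ_le (phip n) (phi1_gt0 n) (lexx 0) fcs; rewrite mul0r.
  move=> _; rewrite /C (_ : q _ = fun n => t * q f n + 0).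
    by rewrite ulimDZ ?ulim_cst ?addr0//; [exact: qbs|exists 0 => n; rewrite normr0].
  by apply/funext => n; rewrite addr0.
have CD f f' : positive_cs f -> positive_cs f' ->
    C (fun x => f x + f' x) = C f + C f'.
  move=> fp fp'; have fpD := positive_csD fp fp'.
  have CDE : C f + C f' = ulim (fun n => 1 * q f n + q f' n).
    by rewrite ulimDZ ?mul1r//; exact: qbs.
  have sb : bounded_seq (fun n => 1 * q f n + q f' n).
    by apply: bounded_seqDZ; exact: qbs.
  have [[fcs f0] [fcs' f0']] := (fp, fp').
  apply/eqP; rewrite eq_le; apply/andP; split.
    rewrite CDE; apply: ulim_le => //; first exact: qbs.
    near=> n; rewrite mul1r /q -mulrDl ler_wpM2r ?invr_ge0 ?(ltW (d0 n))//.
    exact: coveringD.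
  have [_ [A cA fA0]] := csD fcs fcs'.
  (* The denominator is f + f' + d. The defect d * h1 is dominated by d times
a cutoff that equals 1 on the support of f + f'. *)
  have [f2 [f2cs f201 f2A]] := cutoff polishG lcG cA.
  have f2p : positive_cs f2 by split=> // x; have /andP[] := f201 x.
  have [B hB] := qb _ fpD; have [B2 hB2] := qb _ f2p.
  have B0 : 0 <= B by exact: le_trans (q0 _ 0%N fpD) (hB 0%N).
  have B20 : 0 <= B2 by exact: le_trans (q0 _ 0%N f2p) (hB2 0%N).
  apply/ler_addgt0Pr => e e0.
  have [d dgt0 dE] : exists2 d : R, 0 < d & d * (2 * (B + B2 + 1)) = e.
    exists (e / (2 * (B + B2 + 1))).
      by rewrite divr_gt0// mulr_gt0// ltr_wpDl// addr_ge0.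
    by rewrite divfK// gt_eqF// mulr_gt0// ltr_wpDl// addr_ge0.
  pose s x := f x + f' x + d.
  have s0 x : 0 < s x by rewrite /s ltr_wpDl// addr_ge0.
  have sc : continuous (fun x => (s x)^-1).
    move=> x; apply: cvgV; first by rewrite gt_eqF.
    apply: cvgD; last exact: cvg_cst.
    by apply: cvgD; [exact: fcs.1|exact: fcs'.1].
  pose h1 x := f x / s x; pose h2 x := f' x / s x.
  have h1cs : compactly_supported h1 by exact: csM.
  have h2cs : compactly_supported h2 by exact: csM.
  have h10 x : 0 <= h1 x by rewrite /h1 divr_ge0// ltW.
  have h20 x : 0 <= h2 x by rewrite /h2 divr_ge0// ltW.
  have h12 x : h1 x + h2 x <= 1.
    by rewrite /h1 /h2 -mulrDl ler_pdivrMr// mul1r /s lerDl ltW.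
  have hA x : ~ A x -> f x = 0 /\ f' x = 0.
    move=> nA; have := fA0 x nA; have := f0 x; have := f0' x.
    by move=> ? ? ?; split; lra.
  have hs x : h1 x * s x = f x /\ h2 x * s x = f' x.
    by rewrite !divfK ?gt_eqF.
  have hf x : h1 x <= f2 x /\ h2 x <= f2 x.
    have := h12 x; have := h10 x; have := h20 x => ? ? ?.
    have [Ax|nAx] := pselect (A x); first by rewrite f2A//; split; lra.
    have [fx0 fx0'] := hA x nAx.
    by rewrite /h1 /h2 fx0 fx0' mul0r; have /andP[] := f201 x.
  have u1 := cs_uniformly_continuous h1cs dgt0.
  have u2 := cs_uniformly_continuous h2cs dgt0.
  have near_n := phiU _ (@filterI _ _ (nbhs_filter (1%g : G)) _ _ u1 u2).
  have qle : \forall n \near \oo,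
      1 * q f n + q f' n <= 1 * q (fun x => f x + f' x) n + e.
    apply: filterS near_n => n hn; rewrite !mul1r.
    have := @covering_split _ _ (phi n) (phip n) (phi1_gt0 n) f f' f2 h1 h2 d _
      fcs fcs' f2cs dgt0 (fun x => conj (h10 x) (h20 x)) h12 _ _ hn _ _.
    set c1 := covering _ _; set c2 := covering _ _; set c3 := covering _ _.
    set c4 := covering _ _ => hc.
    have {}hc : c1 + c2 <= (1 + 2 * d) * c3 + 2 * d * c4.
      apply: hc => [x|x|u x [hu _]|u x [_ hu]].
      - have [h _] := hs x; have [h' _] := hf x; rewrite -[leLHS]h /s; nra.
      - have [_ h] := hs x; have [_ h'] := hf x; rewrite -[leLHS]h /s; nra.
      - exact: hu.
      - exact: hu.
    have := hB n; have := hB2 n; rewrite /q !ler_pdivrMr// -/c3 -/c4.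
    rewrite -mulrDl ler_pdivrMr// mulrDl divfK ?gt_eqF// -/c1 -/c2.
    move: (d0 n); set D := covering _ _ => D0 h4 h3.
    have : 0 <= d * D by rewrite mulr_ge0 ?(ltW D0) ?(ltW dgt0).
    have h3' : d * c3 <= d * (B * D) by rewrite ler_wpM2l ?(ltW dgt0).
    have h4' : d * c4 <= d * (B2 * D) by rewrite ler_wpM2l ?(ltW dgt0).
    by rewrite -dE; lra.
  have be : bounded_seq (fun _ : nat => e) by exists `|e|.
  have := ulim_le sb (bounded_seqDZ 1 (qbs _ fpD) be) qle.
  by rewrite -CDE ulimDZ ?ulim_cst ?mul1r//; exact: qbs.
have Cge0 f : positive_cs f -> 0 <= C f.
  move=> fp; rewrite -[leLHS](@ulim_cst R); apply: ulim_le.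
  - by exists 0 => n; rewrite normr0.
  - exact: qbs.
  by near=> n; exact: q0.
have CT g f : positive_cs f -> C (translate g f) = C f.
  move=> [fcs _]; congr ulim; apply/funext => n.
  by rewrite /q covering_translate.
have tp (g : G) (f : G -> R) : positive_cs f -> positive_cs (translate g f).
  by move=> [fcs f0]; split; [exact: cs_translate|move=> x; exact: f0].
split; apply: (@Haar _ _ (extension C)).
- exact: extensionDZ.
- by move=> f fp; rewrite extension_positive//; exact: Cge0.
- move=> g f fcs.
  rewrite (extensionE CD (cs_translate g fcs) (tp g _ (positive_part_cs fcs))
    (tp g _ (negative_part_cs fcs))).
    by rewrite !CT//; [exact: negative_part_cs|exact: positive_part_cs].
  by move=> x; exact: partsE.
exists (phi 0%N) => //; rewrite extension_positive//.
rewrite /C (_ : q _ = fun=> 1) ?ulim_cst//.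
by apply/funext => n; rewrite /q divff// gt_eqF.
Unshelve. all: by end_near. Qed.

End Haar.

(** * A slowly varying integrable weight *)

Section HaarFacts.
Context {R : realType} {G : topologicalGroupType} (I : haar_functional R G).
Implicit Types (f : G -> R) (t : R).

Lemma haar0 : I (fun=> 0) = 0.
Proof.
have := haarDZ I (-1) (@cs0 R G) (@cs0 R G).
rewrite (_ : (fun x => _) = fun=> 0); first by lra.
by apply/funext => x; rewrite mulr0 addr0.
Qed.

Lemma haarZ t f : compactly_supported f -> I (fun x => t * f x) = t * I f.
Proof.
move=> fcs; have := haarDZ I t fcs (@cs0 R G); rewrite haar0 addr0 => <-.
by congr (I _); apply/funext => x; rewrite addr0.
Qed.

Lemma haarD f f' : compactly_supported f -> compactly_supported f' ->
  I (fun x => f x + f' x) = I f + I f'.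
Proof.
move=> fcs fcs'; have := haarDZ I 1 fcs fcs'; rewrite mul1r => <-.
by congr (I _); apply/funext => x; rewrite mul1r.
Qed.

Lemma haar_le f f' : compactly_supported f -> compactly_supported f' ->
  (forall x, f x <= f' x) -> I f <= I f'.
Proof.
move=> fcs fcs' ff'; have := haarDZ I (-1) fcs fcs'.
have : 0 <= I (fun x => -1 * f x + f' x).
  apply: haar_ge0; split; first by apply: csD => //; exact: csZ.
  by move=> x; have := ff' x; lra.
by move=> + E; rewrite E; lra.
Qed.

Lemma haar_sum (J : eqType) (s : seq J) (F : J -> G -> R) :
    (forall j, j \in s -> compactly_supported (F j)) ->
  I (fun x => \sum_(j <- s) F j x) = \sum_(j <- s) I (F j).
Proof.
elim: s => [|j s IH] sF.
  by rewrite big_nil -[RHS]haar0; congr (I _); apply/funext => x; rewrite big_nil.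
have sF' i : i \in s -> compactly_supported (F i).
  by move=> si; apply: sF; rewrite inE si orbT.
rewrite big_cons -IH// -haarD; [|by apply: sF; rewrite mem_head|exact: cs_sum].
by congr (I _); apply/funext => x; rewrite big_cons.
Qed.

End HaarFacts.

Lemma dense_sequence (G : topologicalGroupType) : separable_space G ->
  exists s : nat -> G, dense (range s).
Proof.
move=> [D cD dD]; have /pcard_injP[f] := cD.
pose s n := xget (1%g : G) [set x | D x /\ f x = n].
move=> fI; exists s => O O0 oO; have [x [Ox Dx]] := dD O O0 oO.
exists x; split=> //; exists (f x) => //.
rewrite /s; case: xgetP => [y _ [Dy fxy]|/(_ x)]; last by case.
by apply: fI; rewrite ?inE.
Qed.

Section Weight.
Context {R : realType} {G : topologicalGroupType} (I : haar_functional R G).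
Variables (V : set G) (s : nat -> G) (F : nat -> seq G).
Hypothesis V1 : nbhs (1%g : G) V.
Hypothesis s0 : s 0%N = 1%g.
Hypothesis Vs : forall x, exists n, exists2 a, V a & x = (a * s n)%g.
Hypothesis VsV : forall n a b, V a -> V b ->
  exists2 g, g \in F n & V (g^-1 * (a * s n * b))%g.
Implicit Types (x y g : G) (l : seq nat) (f : G -> R) (m n : nat).

Let V_1 : V 1%g. Proof. exact: nbhs_singleton. Qed.

(** The factor size (F n) + 1 compensates the number of translates of
[V] that the letter [n] contributes, and the power of 2 makes the sum over the
letters at most 1/2. *)
Definition cost n : R := 2 ^+ n.+2 * ((size (F n)).+1)%:R.

Definition word_cost l : R := \prod_(n <- l) cost n.

(** The set V s_(n_1) V s_(n_2) V ... s_(n_k) V of the word n_1 ... n_k. *)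
Fixpoint word_set l : set G :=
  if l is n :: l' then
    [set x | exists a y, [/\ V a, word_set l' y & x = (a * s n * y)%g]]
  else V.

Definition raw_weight x : R :=
  sup [set t | exists2 l, word_set l x & t = (word_cost l)^-1].

Lemma cost_ge n : 2 ^+ n.+2 <= cost n.
Proof. by rewrite /cost ler_peMr ?exprn_ge0// ler1n. Qed.

Lemma cost_ge1 n : 1 <= cost n.
Proof. by apply: le_trans (cost_ge n); rewrite exprn_ege1// ler1n. Qed.

Lemma cost_gt0 n : 0 < cost n.
Proof. exact: lt_le_trans (cost_ge1 n). Qed.

Lemma word_cost_ge1 l : 1 <= word_cost l.
Proof.
elim: l => [|n l IH]; first by rewrite /word_cost big_nil.
rewrite /word_cost big_cons -/(word_cost l).
by have := cost_ge1 n; nra.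
Qed.

Lemma word_cost_gt0 l : 0 < word_cost l.
Proof. exact: lt_le_trans (word_cost_ge1 l). Qed.

Lemma word_cost_cons n l : word_cost (n :: l) = cost n * word_cost l.
Proof. exact: big_cons. Qed.

Lemma word_cost_size l : 2 ^+ size l <= word_cost l.
Proof.
elim: l => [|n l IH]; first by rewrite /word_cost big_nil.
rewrite word_cost_cons exprS ler_pM ?exprn_ge0//.
apply: le_trans (cost_ge n); rewrite -[leLHS]expr1.
by rewrite ler_eXn2l ?ltr1n.
Qed.

Lemma word_cost_mem l n : n \in l -> 2 ^+ n <= word_cost l.
Proof.
elim: l => // k l IH; rewrite inE word_cost_cons => /orP[/eqP ->|nl].
  have h : 2 ^+ k <= cost k :> R.
    apply: le_trans (cost_ge k); rewrite ler_eXn2l ?ltr1n//.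
    by rewrite -addn2 leq_addr.
  have := word_cost_ge1 l; have := cost_gt0 k; nra.
have := IH nl; have := cost_ge1 k; have := word_cost_gt0 l; nra.
Qed.

Lemma raw_weight_has_sup x :
  has_sup [set t | exists2 l, word_set l x & t = (word_cost l)^-1].
Proof.
split.
  have [n [a Va xE]] := Vs x; exists (word_cost [:: n])^-1, [:: n] => //.
  by exists a, 1%g; split; [|exact: V_1|rewrite mulg1].
by exists 1 => _ [l _ ->]; rewrite invf_le1 ?word_cost_gt0// word_cost_ge1.
Qed.

Lemma raw_weight_ge l x : word_set l x -> (word_cost l)^-1 <= raw_weight x.
Proof.
move=> lx; apply: ub_le_sup; first by have [] := raw_weight_has_sup x.
by exists l.
Qed.

Lemma raw_weight_le x t :
  (forall l, word_set l x -> (word_cost l)^-1 <= t) -> raw_weight x <= t.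
Proof.
move=> h; apply: ge_sup; first by have [] := raw_weight_has_sup x.
by move=> _ [l lx ->]; exact: h.
Qed.

Lemma raw_weight_gt0 x : 0 < raw_weight x.
Proof.
have [[t [l lx _]] _] := raw_weight_has_sup x.
by apply: lt_le_trans (raw_weight_ge lx); rewrite invr_gt0 word_cost_gt0.
Qed.

(** Prefixing a word of [x] by the letter [n] gives a word of
[a * s n * x]. *)
Lemma raw_weightM n a x : V a ->
  raw_weight x <= cost n * raw_weight (a * s n * x)%g.
Proof.
move=> Va; apply: raw_weight_le => l lx.
have : (word_cost (n :: l))^-1 <= raw_weight (a * s n * x)%g.
  by apply: raw_weight_ge; exists a, x.
by rewrite word_cost_cons invfM ler_pdivrMl ?cost_gt0.
Qed.

Lemma raw_weight_V a x : V a -> raw_weight (a^-1 * x)%g <= cost 0 * raw_weight x.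
Proof.
move=> Va; have := raw_weightM 0 (a^-1 * x)%g Va.
by rewrite s0 mulg1 mulVKg.
Qed.

Lemma raw_weight_mul_le g : exists2 C : R, 0 <= C &
  forall x, raw_weight (g * x)%g <= C * raw_weight x.
Proof.
have [n [a Va gE]] := Vs g^-1%g.
exists (cost n); first exact: ltW (cost_gt0 n).
move=> x; have := raw_weightM n (g * x)%g Va.
by rewrite -gE mulKg.
Qed.

(** Summing over the letters [n < m] and over the translates that cover
[V * s n * V], with the inverse costs as coefficients. Its iterates dominate the
raw weight, and it at least halves the Haar functional of nonnegative functions. *)
Definition spread m f x : R :=
  \sum_(n <- iota 0 m) (cost n)^-1 * \sum_(g <- F n) translate g f x.

Definition spreads m k f : G -> R := iter k (spread m) f.

Lemma spread_cs m f : compactly_supported f -> compactly_supported (spread m f).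
Proof.
move=> fcs; apply: cs_sum => n _; apply: csZ; apply: cs_sum => g _.
exact: cs_translate.
Qed.

Lemma spread_ge0 m f x : (forall x, 0 <= f x) -> 0 <= spread m f x.
Proof.
move=> f0; apply: sumr_ge0 => n _; rewrite mulr_ge0 ?invr_ge0 ?(ltW (cost_gt0 n))//.
by apply: sumr_ge0 => g _; exact: f0.
Qed.

Lemma spreads_cs m k f : compactly_supported f -> compactly_supported (spreads m k f).
Proof. by move=> fcs; elim: k => //= k IH; exact: spread_cs. Qed.

Lemma spreads_ge0 m k f x : (forall x, 0 <= f x) -> 0 <= spreads m k f x.
Proof.
by move=> f0; elim: k x => //= k IH x; apply: spread_ge0 => y; exact: IH.
Qed.

Lemma geometric_le m (c : R) : 0 <= c ->
  \sum_(n <- iota 0 m) c / 2 ^+ n.+1 <= c.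
Proof.
move=> c0; have h : \sum_(n <- iota 0 m) c / 2 ^+ n.+1 = c - c / 2 ^+ m.
  elim: m => [|m IH]; first by rewrite big_nil expr0 divr1 subrr.
  rewrite -addn1 iotaD big_cat /= big_seq1 IH add0n addn1 exprS.
  by field; rewrite expf_neq0.
by rewrite h gerBl divr_ge0// exprn_ge0.
Qed.

Lemma haar_spread_le m f : positive_cs f -> I (spread m f) <= I f / 2.
Proof.
move=> [fcs f0]; have If0 : 0 <= I f by exact: haar_ge0.
rewrite haar_sum; last first.
  by move=> n _; apply: csZ; apply: cs_sum => g _; exact: cs_translate.
have If2 : 0 <= I f / 2 by rewrite divr_ge0.
apply: le_trans (geometric_le m If2); apply: ler_sum => n _.
rewrite haarZ; last by apply: cs_sum => g _; exact: cs_translate.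
rewrite haar_sum; last by move=> g _; exact: cs_translate.
have -> : \sum_(g <- F n) I (translate g f) = (size (F n))%:R * I f.
  rewrite -sum1_size natr_sum mulr_suml; apply: eq_bigr => g _.
  by rewrite haar_translate// mul1r.
rewrite ler_pdivrMl ?cost_gt0// /cost.
have -> : 2 ^+ n.+2 * (size (F n)).+1%:R * (I f / 2 / 2 ^+ n.+1) =
   (size (F n)).+1%:R * I f :> R by rewrite !exprS; field; rewrite expf_neq0.
by rewrite ler_wpM2r// ler_nat.
Qed.

Lemma haar_spreads_le m k f : positive_cs f -> I (spreads m k f) <= I f / 2 ^+ k.
Proof.
move=> [fcs f0]; elim: k => [|k IH]; first by rewrite expr0 divr1.
have p : positive_cs (spreads m k f).
  by split; [exact: spreads_cs|move=> x; exact: spreads_ge0].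
rewrite /spreads iterS -/(spreads m k f); apply: le_trans (haar_spread_le m p) _.
by rewrite exprS invfM mulrCA [leRHS]mulrC ler_pM2r.
Qed.

(** The first factor of a point of a word set may be any element of [V].
It is the factor that is lost when [V * s n * V] is covered by translates of
[V]. *)
Lemma word_set_V l x : word_set l x -> exists b r,
  [/\ V b, x = (b * r)%g & forall b', V b' -> word_set l (b' * r)%g].
Proof.
case: l => [|n l] /=.
  by move=> Vx; exists x, 1%g; split=> [//||b Vb]; rewrite mulg1.
move=> [a [y [Va ly ->]]]; exists a, (s n * y)%g.
split=> [//||b Vb]; first by rewrite mulgA.
by exists b, y; split=> //; rewrite mulgA.
Qed.

Lemma spreads_ge m h l x : (forall x, 0 <= h x) -> (forall x, V x -> 1 <= h x) ->
    (forall n, n \in l -> (n < m)%N) -> word_set l x ->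
  (word_cost l)^-1 <= spreads m (size l) h x.
Proof.
move=> h0 hV; elim: l x => [|n l IH] x lm /=.
  by rewrite /word_cost big_nil invr1 => /hV.
move=> [a [y [Va ly xE]]].
have [b [r [Vb yE br]]] := word_set_V ly.
have [g gF gV] := VsV n Va Vb.
have gx : word_set l (g^-1 * x)%g.
  by have := br _ gV; rewrite xE yE !mulgA.
have nm : n \in iota 0 m by rewrite mem_iota /= add0n lm// mem_head.
have lm' k : k \in l -> (k < m)%N by move=> kl; apply: lm; rewrite inE kl orbT.
have := IH _ lm' gx.
rewrite word_cost_cons invfM /spread (big_rem n)//= => IHx.
apply: (@le_trans _ _ ((cost n)^-1 * spreads m (size l) h (g^-1 * x)%g)).
  by rewrite ler_wpM2l// invr_ge0 ltW// cost_gt0.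
apply: (@le_trans _ _ ((cost n)^-1 *
   \sum_(g <- F n) translate g (spreads m (size l) h) x)).
  rewrite ler_wpM2l ?invr_ge0 ?(ltW (cost_gt0 n))// (big_rem g)//= lerDl.
  by apply: sumr_ge0 => k _; exact: spreads_ge0.
rewrite lerDl; apply: sumr_ge0 => k _.
rewrite mulr_ge0 ?invr_ge0 ?(ltW (cost_gt0 k))//.
by apply: sumr_ge0 => k' _; exact: spreads_ge0.
Qed.

(** A word with at least [m] letters, or with a letter at least [m],
costs at least 2 ^ m; the other words are dominated by the iterates of the
spreading operator. *)
Lemma raw_weight_le_spreads m h x :
    (forall x, 0 <= h x) -> (forall x, V x -> 1 <= h x) ->
  raw_weight x <= (2 ^+ m)^-1 + \sum_(k <- iota 0 m) spreads m k h x.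
Proof.
move=> h0 hV; apply: raw_weight_le => l lx.
have S0 : 0 <= \sum_(k <- iota 0 m) spreads m k h x.
  by apply: sumr_ge0 => k _; exact: spreads_ge0.
have m0 : 0 < 2 ^+ m :> R by rewrite exprn_gt0.
have [sm|ms] := ltnP (size l) m; last first.
  apply: (@le_trans _ _ (2 ^+ m)^-1); last by rewrite lerDl.
  rewrite lef_pV2 ?posrE ?word_cost_gt0//.
  by apply: le_trans (word_cost_size l); rewrite ler_eXn2l ?ltr1n.
have [/allP lm|/allPn[n nl]] := boolP (all (fun n => n < m)%N l); last first.
  rewrite -leqNgt => mn; apply: (@le_trans _ _ (2 ^+ m)^-1); last by rewrite lerDl.
  rewrite lef_pV2 ?posrE ?word_cost_gt0//.
  by apply: le_trans (word_cost_mem nl); rewrite ler_eXn2l ?ltr1n.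
apply: le_trans (spreads_ge h0 hV lm lx) _.
have sl : size l \in iota 0 m by rewrite mem_iota.
apply: (@le_trans _ _ (\sum_(k <- iota 0 m) spreads m k h x)).
  rewrite (big_rem (size l))//= lerDl.
  by apply: sumr_ge0 => k _; exact: spreads_ge0.
by rewrite lerDr invr_ge0 ltW.
Qed.

Variable h : G -> R.
Hypothesis h_cs : compactly_supported h.
Hypothesis h01 : forall x, 0 <= h x <= 1.
Hypothesis h1 : h 1%g = 1.
Hypothesis hV : forall x, ~ V x -> h x = 0.

(** The raw weight need not be continuous. Taking the supremum over left
translations, weighted by a bump, makes it vary slowly under left translations,
hence continuous, and changes it by a bounded factor only. *)
Definition smooth_weight x : R :=
  sup (range (fun y => h y * raw_weight (y^-1 * x)%g)).

Let C0 := cost 0.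
Let C0_gt0 : 0 < C0. Proof. exact: cost_gt0. Qed.

Lemma smooth_term_le x y : h y * raw_weight (y^-1 * x)%g <= C0 * raw_weight x.
Proof.
have /andP[hy0 hy1] := h01 y.
have [Vy|/hV ->] := pselect (V y); last first.
  by rewrite mul0r mulr_ge0 ?(ltW C0_gt0) ?(ltW (raw_weight_gt0 x)).
apply: le_trans (raw_weight_V x Vy).
by rewrite ler_piMl// ltW// raw_weight_gt0.
Qed.

Lemma smooth_weight_ub x y : h y * raw_weight (y^-1 * x)%g <= smooth_weight x.
Proof.
apply: ub_le_sup; last by exists y.
by exists (C0 * raw_weight x) => _ [z _ <-]; exact: smooth_term_le.
Qed.

Lemma smooth_weight_lub x t :
  (forall y, h y * raw_weight (y^-1 * x)%g <= t) -> smooth_weight x <= t.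
Proof.
move=> ht; apply: ge_sup; first by exists (h 1%g * raw_weight (1^-1 * x)%g), 1%g.
by move=> _ [y _ <-].
Qed.

Lemma smooth_weight_le x : smooth_weight x <= C0 * raw_weight x.
Proof. by apply: smooth_weight_lub => y; exact: smooth_term_le. Qed.

Lemma smooth_weight_ge x : raw_weight x <= smooth_weight x.
Proof. by have := smooth_weight_ub x 1%g; rewrite h1 mul1r invg1 mul1g. Qed.

Lemma smooth_weight_gt0 x : 0 < smooth_weight x.
Proof. exact: lt_le_trans (raw_weight_gt0 x) (smooth_weight_ge x). Qed.

Lemma smooth_weight_mul_le g : exists C : R,
  forall x, smooth_weight (g * x)%g <= C * smooth_weight x.
Proof.
have [C C_ge0 hC] := raw_weight_mul_le g.
exists (C0 * C) => x; apply: le_trans (smooth_weight_le _) _.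
rewrite -mulrA ler_wpM2l ?(ltW C0_gt0)//.
by apply: le_trans (hC x) _; rewrite ler_wpM2l// smooth_weight_ge.
Qed.

(** Substituting y = g z in the supremum that defines the weight at
[g * x] compares it with the one at [x] through h (g z) - h z, which is uniformly
small by left uniform continuity of [h]. *)
Lemma smooth_weight_near (e : R) : 0 < e -> \forall g \near (1%g : G),
  forall x, smooth_weight (g * x)%g <= (1 + e) * smooth_weight x.
Proof.
move=> e0; pose d := e / C0 ^+ 2.
have d0 : 0 < d by rewrite divr_gt0// exprn_gt0.
have dE : d * C0 ^+ 2 = e by rewrite divfK// gt_eqF// exprn_gt0.
have n1 := near1_inv (cs_luc h_cs d0).
have n2 := near1_inv V1.
apply: filterS2 n1 n2 => g hg Vg x.
apply: smooth_weight_lub => y.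
have [Vy|/hV ->] := pselect (V y); last first.
  rewrite mul0r mulr_ge0 ?(ltW (smooth_weight_gt0 x))//.
  by rewrite addr_ge0// ltW.
pose z := (g^-1 * y)%g.
have yE : y = (g * z)%g by rewrite /z mulVKg.
have hz : h y <= h z + d.
  have := hg z; rewrite /translate invgK -yE ler_norml => /andP[_]; lra.
have zx : (y^-1 * (g * x) = z^-1 * x)%g by rewrite yE invgM -mulgA mulKg.
have r1 : raw_weight (z^-1 * x)%g <= C0 ^+ 2 * raw_weight x.
  rewrite -zx; apply: le_trans (raw_weight_V _ Vy) _.
  rewrite expr2 -mulrA ler_wpM2l ?(ltW C0_gt0)//.
  have := raw_weight_V x Vg; by rewrite invgK.
rewrite zx.
have r0 := raw_weight_gt0 (z^-1 * x)%g.
have s1 := smooth_weight_ub x z.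
have s2 := smooth_weight_ge x.
have r2 : h y * raw_weight (z^-1 * x)%g <= (h z + d) * raw_weight (z^-1 * x)%g.
  by rewrite ler_wpM2r// ltW.
have r3 : d * raw_weight (z^-1 * x)%g <= e * raw_weight x.
  by rewrite -dE -mulrA ler_wpM2l// ltW.
have r4 : e * raw_weight x <= e * smooth_weight x by rewrite ler_wpM2l// ltW.
by lra.
Qed.

Lemma smooth_weight_continuous : continuous smooth_weight.
Proof.
move=> x; apply/cvgrPdist_lt => e e0.
have v0 := smooth_weight_gt0 x.
pose d := e / (2 * smooth_weight x).
have d0 : 0 < d by rewrite divr_gt0// mulr_gt0.
have dE : d * smooth_weight x * 2 = e.
  by rewrite -mulrA (mulrC (smooth_weight x)) divfK// gt_eqF// mulr_gt0.
have n1 := smooth_weight_near d0.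
have n2 := near1_inv n1.
have n3 := near1_divr x (@filterI _ _ (nbhs_filter (1%g : G)) _ _ n1 n2).
apply: filterS n3 => y [/(_ x) hy1 /(_ y) hy2].
rewrite mulgVK in hy1; rewrite invgM invgK mulgVK in hy2.
rewrite ltr_norml; apply/andP; split; first by lra.
have [|vyx] := leP (smooth_weight x) (smooth_weight y); first by lra.
have : d * smooth_weight y <= d * smooth_weight x by rewrite ler_wpM2l// ltW.
lra.
Qed.

(** The cutoff [c] makes the constant error of [raw_weight_le_spreads]
integrable, and this error tends to 0 as [m] grows. The iterates of the spreading
operator contribute a geometric series. *)
Lemma smooth_weight_integrable (f1 : G -> R) : positive_cs f1 ->
    (forall x, V x -> 1 <= f1 x) ->
  exists B : R, forall c, compactly_supported c -> (forall x, 0 <= c x <= 1) ->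
    I (fun x => c x * smooth_weight x) <= B.
Proof.
move=> f1p f1V; have [f1cs f10] := f1p; exists (C0 * (1 + 2 * I f1)) => c ccs c01.
have cp : positive_cs c by split=> // x; have /andP[] := c01 x.
have Ic0 : 0 <= I c by exact: haar_ge0.
have If0 : 0 <= I f1 by exact: haar_ge0.
(* [m] is chosen so large that I c / 2 ^ m <= 1. *)
pose m := (Num.truncn (I c)).+1.
have m0 : 0 < 2 ^+ m :> R by rewrite exprn_gt0.
have Icm : I c <= 2 ^+ m.
  apply: ltW; apply: lt_le_trans (truncnS_gt _) _.
  by rewrite -natrX ler_nat ltnW// ltn_expl.
pose S x := \sum_(k <- iota 0 m) spreads m k f1 x.
have Scs : compactly_supported S by apply: cs_sum => k _; exact: spreads_cs.
have IS : I S <= 2 * I f1.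
  rewrite haar_sum; last by move=> k _; exact: spreads_cs.
  have If2 : 0 <= 2 * I f1 by rewrite mulr_ge0.
  apply: le_trans (geometric_le m If2); apply: ler_sum => k _.
  apply: le_trans (haar_spreads_le m k f1p) _.
  by rewrite exprS invfM mulrA [_ / 2]mulrC mulrA mulVf ?mul1r.
have le1 : I (fun x => c x * smooth_weight x) <=
    I (fun x => C0 * ((2 ^+ m)^-1 * c x + S x)).
  apply: haar_le; first by apply: csM => //; exact: smooth_weight_continuous.
    by apply: csZ; apply: csD => //; exact: csZ.
  move=> x; have /andP[cx0 cx1] := c01 x.
  apply: (@le_trans _ _ (c x * (C0 * raw_weight x))).
    by rewrite ler_wpM2l// smooth_weight_le.
  rewrite mulrCA ler_wpM2l ?(ltW C0_gt0)//.
  apply: (@le_trans _ _ (c x * ((2 ^+ m)^-1 + S x))).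
    by rewrite ler_wpM2l// raw_weight_le_spreads.
  have Sx0 : 0 <= S x by apply: sumr_ge0 => k _; exact: spreads_ge0.
  have : 0 <= (2 ^+ m : R)^-1 by rewrite invr_ge0 ltW.
  by nra.
apply: le_trans le1 _.
rewrite haarZ; last by apply: csD => //; exact: csZ.
rewrite haarD//; last exact: csZ.
rewrite haarZ// ler_wpM2l ?(ltW C0_gt0)// lerD//.
by rewrite ler_pdivrMl// mulr1.
Qed.

End Weight.

Theorem exists_integrable_weight (R : realType) (G : topologicalGroupType)
    (I : haar_functional R G) : polish_space R G -> locally_compact [set: G] ->
  exists v : G -> R, [/\ continuous v, forall x, 0 < v x,
    forall g, exists C : R, forall x, v (g * x)%g <= C * v x,
    forall e : R, 0 < e -> \forall g \near (1%g : G),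
      forall x, v (g * x)%g <= (1 + e) * v x &
    exists B : R, forall c, compactly_supported c -> (forall x, 0 <= c x <= 1) ->
      I (fun x => c x * v x) <= B].
Proof.
move=> polishG lcG.
have [V cV V1] := compact_nbhs1 lcG.
have [s sd] := dense_sequence polishG.1.
(* The letter 0 stands for the set [V] itself. *)
pose s' n := if n is k.+1 then s k else 1%g.
have Vs x : exists n, exists2 a, V a & x = (a * s' n)%g.
  have c : (x * y^-1)%g @[y --> x] --> (1%g : G).
    rewrite -(mulgV x); apply: (cvg_comp (fun y : G => (y^-1)%g) (fun y => (x * y)%g)).
      exact: invg_continuous.
    exact: mulgl_continuous.
  have Wx : nbhs x [set y | V (x * y^-1)%g] by have := c _ V1.
  have [|y [Wy [n _ snE]]] := sd _ _ (open_interior [set y | V (x * y^-1)%g]).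
    by exists x; exact: nbhs_singleton (nbhs_interior Wx).
  exists n.+1; exists (x * y^-1)%g; first exact: (interior_subset Wy).
  by rewrite /= snE mulgVK.
have VsV n : exists F : seq G, forall a b, V a -> V b ->
    exists2 g, g \in F & V (g^-1 * (a * s' n * b))%g.
  have opc : continuous (fun p : G * G => (p.1 * s' n * p.2)%g).
    move=> [a b]; set g := s' n.
    apply: (cvg_comp (G := nbhs ((a * g)%g, b)) (fun p => ((p.1 * g)%g, p.2))
      (fun q : G * G => (q.1 * q.2)%g));
      last exact: (@mulg_continuous G ((a * g)%g, b)).
    apply: (cvg_pair (f := fun p : G * G => (p.1 * g)%g) (g := snd));
      last exact: cvg_snd.
    apply: (cvg_comp (G := nbhs a) fst (fun x => (x * g)%g)); first exact: cvg_fst.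
    exact: mulgr_continuous.
  have [F hF] := compact_finite_translates (compact_image2 opc cV cV) V1.
  by exists F => a b Va Vb; apply: hF; exists a => //; exists b.
have [F hF] := choice VsV.
have [h [hcs h01 h1 hV]] := bump polishG lcG V1.
have [f1 [f1cs f101 f1V]] := cutoff polishG lcG cV.
have f1p : positive_cs f1 by split=> // x; have /andP[] := f101 x.
exists (smooth_weight V s' F h); split.
- exact: smooth_weight_continuous.
- by move=> x; exact: smooth_weight_gt0.
- by move=> g; exact: smooth_weight_mul_le.
- by move=> e; exact: smooth_weight_near.
- apply: smooth_weight_integrable f1p _ => // x Vx; by rewrite f1V.
Qed.

(** * Quasi-invariant means *)

(** What the affine action needs of the probability measure with density
[v] for the Haar functional. The last field also controls translations from
below, and it makes the translations of functionals strongly continuous. *)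
Record quasi_invariant_mean (R : realType) (G : topologicalGroupType) := Mean {
  mean :> (G -> R) -> R ;
  meanDZ : forall t f f', bounded_continuous f -> bounded_continuous f' ->
    mean (fun x => t * f x + f' x) = t * mean f + mean f' ;
  mean_ge0 : forall f, bounded_continuous f -> (forall x, 0 <= f x) ->
    0 <= mean f ;
  mean1 : mean (fun=> 1) = 1 ;
  mean_translate_le : forall g, exists C : R, forall f,
    bounded_continuous f -> (forall x, 0 <= f x) ->
    mean (translate g f) <= C * mean f ;
  mean_translate_near : forall e : R, 0 < e ->
    \forall h \near (1%g : G), forall f,
      bounded_continuous f -> (forall x, 0 <= f x) ->
      `|mean (translate h f) - mean f| <= e * mean f }.

Section Mean.
Context {R : realType} {G : topologicalGroupType}.
Variable (M : quasi_invariant_mean R G).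
Implicit Types (f : G -> R) (g h x y : G) (t : R).

Lemma eq_mean f f' : f =1 f' -> M f = M f'.
Proof. by move=> /funext ->. Qed.

Lemma mean_cst t : M (fun=> t) = t.
Proof.
have := meanDZ M (t - 1) (bc_cst 1) (bc_cst 1).
rewrite mean1 mulr1 subrK => {2}<-; apply: eq_mean => x; ring.
Qed.

Lemma meanZ t f : bounded_continuous f -> M (fun x => t * f x) = t * M f.
Proof.
move=> fb; have := meanDZ M t fb (bc_cst 0).
by rewrite mean_cst addr0 => <-; apply: eq_mean => x; rewrite addr0.
Qed.

Lemma meanD f f' : bounded_continuous f -> bounded_continuous f' ->
  M (fun x => f x + f' x) = M f + M f'.
Proof.
move=> fb fb'; have := meanDZ M 1 fb fb'.
by rewrite mul1r => <-; apply: eq_mean => x; rewrite mul1r.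
Qed.

Lemma meanB f f' : bounded_continuous f -> bounded_continuous f' ->
  M (fun x => f x - f' x) = M f - M f'.
Proof.
move=> fb fb'; have := meanDZ M (-1) fb' fb.
rewrite mulN1r addrC => <-; apply: eq_mean => x; by rewrite mulN1r addrC.
Qed.

Lemma mean_le f f' : bounded_continuous f -> bounded_continuous f' ->
  (forall x, f x <= f' x) -> M f <= M f'.
Proof.
move=> fb fb' ff'; rewrite -subr_ge0 -meanB//; apply: mean_ge0.
  exact: bcB.
by move=> x; rewrite subr_ge0.
Qed.

Definition covariance f f' := M (fun x => f x * f' x) - M f * M f'.

Definition centered f : G -> R := fun x => f x - M f.

Lemma bc_centered f : bounded_continuous f -> bounded_continuous (centered f).
Proof. by move=> fb; apply: bcB => //; exact: bc_cst. Qed.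

Lemma covarianceE f f' : bounded_continuous f -> bounded_continuous f' ->
  covariance f f' = M (fun x => centered f x * centered f' x).
Proof.
move=> fb fb'; rewrite /centered.
rewrite (eq_mean (f' := fun x => (f x * f' x - M f' * f x)
  - (M f * f' x - M f * M f'))); last by move=> x; ring.
have b1 := bcM fb fb'; have b2 := bcZ (M f') fb; have b3 := bcZ (M f) fb'.
have b4 := @bc_cst R G (M f * M f').
rewrite (meanB (bcB b1 b2) (bcB b3 b4)) (meanB b1 b2) (meanB b3 b4).
by rewrite (meanZ _ fb) (meanZ _ fb') mean_cst /covariance; ring.
Qed.

Lemma variance_ge0 f : bounded_continuous f -> 0 <= covariance f f.
Proof.
move=> fb; rewrite covarianceE//; apply: mean_ge0.
  by apply: bcM; exact: bc_centered.
by move=> x; rewrite -expr2 sqr_ge0.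
Qed.

Lemma variance_le_mean_sqr f : bounded_continuous f ->
  covariance f f <= M (fun x => f x * f x).
Proof. by move=> fb; rewrite /covariance -expr2 lerBlDr lerDl sqr_ge0. Qed.

(** Quasi-invariance applied to the square of f - M f. The mean square
deviation of [translate g f] from [M f] splits into its variance and the square
of the displacement of its mean, so one inequality shows both that translations
are bounded for the variance and that the cocycle is. *)
Lemma variance_translate_le g (C : R) f : bounded_continuous f ->
    (forall p, bounded_continuous p -> (forall x, 0 <= p x) ->
       M (translate g p) <= C * M p) ->
  covariance (translate g f) (translate g f) + (M (translate g f) - M f) ^+ 2
    <= C * covariance f f.
Proof.
move=> fb gC; have cb := bc_centered fb.
have b1 : bounded_continuous (fun x => centered f x * centered f x) by exact: bcM.
have sq0 x : 0 <= centered f x * centered f x by rewrite -expr2 sqr_ge0.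
have := gC _ b1 sq0; rewrite -covarianceE//; apply: le_trans.
have tb := bc_translate g fb.
have tt := bcM tb tb.
rewrite /covariance.
rewrite (@eq_mean (translate g (fun x => centered f x * centered f x))
  (fun x => (translate g f x * translate g f x - (2 * M f) * translate g f x)
    + M f * M f)); last by move=> x; rewrite /translate /centered; ring.
have b2 := bcZ (2 * M f) tb; have b3 := @bc_cst R G (M f * M f).
by rewrite (meanD (bcB tt b2) b3) (meanB tt b2) (meanZ _ tb) mean_cst; lra.
Qed.

(** Almost invariance on nonnegative functions passes to products by the
polarization 4 f f' = (f + f')^2 - (f - f')^2. *)
Lemma mean_mul_translate_le (e : R) h f f' : bounded_continuous f ->
    bounded_continuous f' ->
    (forall p, bounded_continuous p -> (forall x, 0 <= p x) ->
       `|M (translate h p) - M p| <= e * M p) ->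
  4 * (M (translate h (fun x => f x * f' x)) - M (fun x => f x * f' x))
    <= 2 * e * (M (fun x => f x * f x) + M (fun x => f' x * f' x)).
Proof.
move=> fb fb' hM.
pose p := fun x => (f x + f' x) * (f x + f' x).
pose q := fun x => (f x - f' x) * (f x - f' x).
have pb : bounded_continuous p by apply: bcM; exact: bcD.
have qb : bounded_continuous q by apply: bcM; exact: bcB.
have p0 x : 0 <= p x by rewrite /p -expr2 sqr_ge0.
have q0 x : 0 <= q x by rewrite /q -expr2 sqr_ge0.
have b := bcM fb fb'; have b1 := bcM fb fb; have b2 := bcM fb' fb'.
have E : 4 * M (fun x => f x * f' x) = M p - M q.
  by rewrite -meanB// -meanZ//; apply: eq_mean => x; rewrite /p /q; ring.
have E' : 4 * M (translate h (fun x => f x * f' x))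
    = M (translate h p) - M (translate h q).
  rewrite -meanB -?meanZ; try exact: bc_translate.
  by apply: eq_mean => x; rewrite /p /q /translate; ring.
have F : 2 * (M (fun x => f x * f x) + M (fun x => f' x * f' x)) = M p + M q.
  rewrite -!meanD// -meanZ; last exact: bcD.
  by apply: eq_mean => x; rewrite /p /q; ring.
rewrite mulrBr E E' (mulrC 2) -mulrA F.
have /ler_normlP[_ hp] := hM p pb p0; have /ler_normlP[hq _] := hM q qb q0.
lra.
Qed.

End Mean.

Section WeightedMean.
Context {R : realType} {G : topologicalGroupType} (I : haar_functional R G).
Variable v : G -> R.
Hypothesis vc : continuous v.
Hypothesis v_gt0 : forall x, 0 < v x.
Hypothesis v_le : forall g, exists C : R, forall x, v (g * x)%g <= C * v x.
Hypothesis v_near : forall e : R, 0 < e -> \forall g \near (1%g : G),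
  forall x, v (g * x)%g <= (1 + e) * v x.
Hypothesis v_integrable : exists B : R, forall c, compactly_supported c ->
  (forall x, 0 <= c x <= 1) -> I (fun x => c x * v x) <= B.
Hypothesis cutoffG : forall A : set G, compact A -> exists f : G -> R,
  [/\ compactly_supported f, forall x, 0 <= f x <= 1 & forall x, A x -> f x = 1].
Implicit Types (f c : G -> R) (g x : G).

Definition is_cutoff c := compactly_supported c /\ forall x, 0 <= c x <= 1.

Definition total_mass : R := sup [set I (fun x => c x * v x) | c in is_cutoff].

Lemma total_mass_has_sup : has_sup [set I (fun x => c x * v x) | c in is_cutoff].
Proof.
split.
  exists (I (fun x => 0 * v x)), (fun=> 0) => //; split; first exact: cs0.
  by move=> x; rewrite lexx ler01.
by have [B hB] := v_integrable; exists B => _ [c [ccs c01] <-]; exact: hB.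
Qed.

Lemma total_mass_ge c : is_cutoff c -> I (fun x => c x * v x) <= total_mass.
Proof.
by move=> cc; apply: ub_le_sup; [have [] := total_mass_has_sup|exists c].
Qed.

(** Since [v] is bounded below on compact sets, a function of positive
Haar value is at most a multiple of [c * v] for a suitable cutoff [c]. *)
Lemma total_mass_gt0 : 0 < total_mass.
Proof.
have [f [fcs f0] If] := haar_neq0 I.
have [_ [A cA fA]] := fcs.
have [c [ccs c01 cA1]] := cutoffG cA.
apply: lt_le_trans (total_mass_ge (conj ccs c01)).
have vic : continuous (fun x => (v x)^-1).
  by move=> x; apply: cvgV; [rewrite gt_eqF|exact: vc].
have fvcs := csM fcs vic.
have [_ [B hB]] := cs_bc fvcs.
have cvcs := csM ccs vc.
have B0 : 0 <= B by exact: le_trans (hB 1%g).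
have : I f <= I (fun x => B * (c x * v x)).
  apply: haar_le => //; first exact: csZ.
  move=> x; have [Ax|nAx] := pselect (A x); last first.
    by rewrite fA// !mulr_ge0 ?(ltW (v_gt0 x))//; have /andP[] := c01 x.
  rewrite cA1// mul1r -ler_pdivrMr//; apply: le_trans (hB x); exact: ler_norm.
rewrite haarZ// => h.
rewrite ltNge; apply/negP => Ic.
have := lt_le_trans If h; rewrite ltNge => /negP; apply.
by rewrite mulr_ge0_le0.
Qed.

Definition weighted f : R := I (fun x => f x * v x) / total_mass.

Lemma weightedDZ (t : R) f f' : compactly_supported f -> compactly_supported f' ->
  weighted (fun x => t * f x + f' x) = t * weighted f + weighted f'.
Proof.
move=> fcs fcs'; rewrite /weighted mulrA -mulrDl; congr (_ / _).
rewrite -(haarDZ I t (csM fcs vc) (csM fcs' vc)).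
by congr (I _); apply/funext => x; ring.
Qed.

Lemma weighted_le f f' : compactly_supported f -> compactly_supported f' ->
  (forall x, f x <= f' x) -> weighted f <= weighted f'.
Proof.
move=> fcs fcs' ff'; rewrite ler_pM2r ?invr_gt0 ?total_mass_gt0//.
apply: haar_le; try exact: csM.
by move=> x; rewrite ler_wpM2r// ltW.
Qed.

Lemma weightedZ (t : R) f : compactly_supported f ->
  weighted (fun x => t * f x) = t * weighted f.
Proof.
move=> fcs; have fcs0 := csZ 0 fcs.
have := weightedDZ t fcs fcs0; have := weightedDZ (-1) fcs0 fcs0.
rewrite (_ : (fun x => -1 * (0 * f x) + 0 * f x) = fun x => 0 * f x); last first.
  by apply/funext => x; ring.
rewrite (_ : (fun x => t * f x + 0 * f x) = fun x => t * f x); last first.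
  by apply/funext => x; ring.
lra.
Qed.

Lemma weightedD f f' : compactly_supported f -> compactly_supported f' ->
  weighted (fun x => f x + f' x) = weighted f + weighted f'.
Proof.
move=> fcs fcs'; rewrite -[X in X + _]mul1r -weightedDZ//; congr weighted.
by apply/funext => x; rewrite mul1r.
Qed.

Lemma weighted_ge0 f : positive_cs f -> 0 <= weighted f.
Proof.
move=> [fcs f0]; rewrite /weighted divr_ge0 ?(ltW total_mass_gt0)//.
apply: haar_ge0; split; first exact: csM.
by move=> x; rewrite mulr_ge0// ltW.
Qed.

Lemma weighted_cutoff_le1 c : is_cutoff c -> weighted c <= 1.
Proof.
by move=> cc; rewrite ler_pdivrMr ?total_mass_gt0// mul1r total_mass_ge.
Qed.

(** Invariance of the Haar functional moves the translation from [f] to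
the density [v]. *)
Lemma weighted_translate_le g (C : R) f : (forall x, v (g * x)%g <= C * v x) ->
  positive_cs f -> weighted (translate g f) <= C * weighted f.
Proof.
move=> vC [fcs f0]; rewrite /weighted mulrA ler_pM2r ?invr_gt0 ?total_mass_gt0//.
have vgc : continuous (fun x => v (g * x)%g).
  move=> x; apply: (cvg_comp (fun x => (g * x)%g) v); last exact: vc.
  exact: mulgl_continuous.
have -> : (fun x => translate g f x * v x) =
    translate g (fun x => f x * v (g * x)%g).
  by apply/funext => x; rewrite /translate mulVKg.
rewrite haar_translate; last exact: csM.
rewrite -haarZ; last exact: csM.
apply: haar_le; [exact: csM|by apply: csZ; exact: csM|].
by move=> x; rewrite mulrCA ler_wpM2l.
Qed.

Lemma exists_cutoffs : exists c : nat -> G -> R,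
  (forall n, is_cutoff (c n)) /\ forall n, 1 - n.+1%:R^-1 < weighted (c n).
Proof.
have A0 := total_mass_gt0.
have h n : exists c, is_cutoff c /\ 1 - n.+1%:R^-1 < weighted c.
  have e0 : 0 < total_mass / n.+1%:R by rewrite divr_gt0.
  have [_ [c cc <-] hc] := sup_adherent e0 total_mass_has_sup.
  exists c; split=> //; rewrite ltr_pdivlMr// mulrBl mul1r mulrC.
  exact: hc.
have [c hc] := choice h; exists c; split=> n; by have [] := hc n.
Qed.

Definition cutoffs : nat -> G -> R := sval (cid exists_cutoffs).

Lemma cutoffs_is_cutoff n : is_cutoff (cutoffs n).
Proof. by have [] := svalP (cid exists_cutoffs). Qed.

Lemma cutoffs_mass n : 1 - n.+1%:R^-1 < weighted (cutoffs n).
Proof. by have [] := svalP (cid exists_cutoffs). Qed.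

Lemma cutoffs_cs n : compactly_supported (cutoffs n).
Proof. by have [] := cutoffs_is_cutoff n. Qed.

Lemma cutoffs01 n x : 0 <= cutoffs n x <= 1.
Proof. by have [_] := cutoffs_is_cutoff n. Qed.

Lemma bc_mul_cutoffs f n : bounded_continuous f ->
  compactly_supported (fun x => f x * cutoffs n x).
Proof.
move=> [fc _]; rewrite (_ : (fun x => _) = fun x => cutoffs n x * f x).
  by apply: csM => //; exact: cutoffs_cs.
by apply/funext => x; rewrite mulrC.
Qed.

Definition truncated f (n : nat) : R := weighted (fun x => f x * cutoffs n x).

Lemma truncated_bounded f : bounded_continuous f -> bounded_seq (truncated f).
Proof.
move=> fb; have [_ [B hB]] := fb; exists B => n.
have B0 : 0 <= B by exact: le_trans (hB 1%g).
have ccs := cutoffs_cs n; have fccs := bc_mul_cutoffs n fb.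
have c1 := weighted_cutoff_le1 (cutoffs_is_cutoff n).
have up : truncated f n <= B * weighted (cutoffs n).
  rewrite -weightedZ//; apply: weighted_le => //; first exact: csZ.
  move=> x; have /andP[c0 _] := cutoffs01 n x; rewrite ler_wpM2r//.
  by apply: le_trans (ler_norm _) (hB x).
have down : - B * weighted (cutoffs n) <= truncated f n.
  rewrite -weightedZ//; apply: weighted_le => //; first exact: csZ.
  move=> x; have /andP[c0 _] := cutoffs01 n x; rewrite ler_wpM2r//.
  by have := hB x; rewrite ler_norml => /andP[].
have c0 : 0 <= weighted (cutoffs n).
  apply: weighted_ge0; split=> // x; by have /andP[] := cutoffs01 n x.
have : 0 <= B * (1 - weighted (cutoffs n)) by rewrite mulr_ge0// subr_ge0.
by rewrite ler_norml => ?; apply/andP; split; lra.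
Qed.

(** The mean of a function that is not compactly supported is defined
along cutoffs whose mass tends to 1. *)
Definition mean_fun f : R := ulim (truncated f).

Lemma mean_funDZ (t : R) f f' : bounded_continuous f -> bounded_continuous f' ->
  mean_fun (fun x => t * f x + f' x) = t * mean_fun f + mean_fun f'.
Proof.
move=> fb fb'; rewrite -ulimDZ; try exact: truncated_bounded.
congr ulim; apply/funext => n; rewrite /truncated.
rewrite -weightedDZ; try exact: bc_mul_cutoffs.
by congr weighted; apply/funext => x; ring.
Qed.

Lemma mean_fun_ge0 f : bounded_continuous f -> (forall x, 0 <= f x) ->
  0 <= mean_fun f.
Proof.
move=> fb f0; rewrite -[leLHS](@ulim_cst R); apply: ulim_le.
- by exists 0 => n; rewrite normr0.
- exact: truncated_bounded.
near=> n; apply: weighted_ge0; split; first exact: bc_mul_cutoffs.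
by move=> x; rewrite mulr_ge0//; have /andP[] := cutoffs01 n x.
Unshelve. all: by end_near. Qed.

Lemma bounded_seq_cst (t : R) : bounded_seq (fun=> t).
Proof. by exists `|t|. Qed.

Lemma cutoffs_mass_near (e : R) : 0 < e ->
  \forall n \near \oo, 1 - e < weighted (cutoffs n).
Proof.
move=> e0; near=> n; apply: lt_trans (cutoffs_mass n).
by rewrite ltrD2l ltrN2; near: n; exact: near_infty_natSinv_lt (PosNum e0).
Unshelve. all: by end_near. Qed.

Lemma mean_fun1 : mean_fun (fun=> 1) = 1.
Proof.
have E n : truncated (fun=> 1) n = weighted (cutoffs n).
  by congr weighted; apply/funext => x; rewrite mul1r.
have tb := truncated_bounded (@bc_cst R G 1).
apply/eqP; rewrite eq_le; apply/andP; split.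
  rewrite -[leRHS](@ulim_cst R); apply: ulim_le => //; first exact: bounded_seq_cst.
  by near=> n; rewrite E; apply: weighted_cutoff_le1; exact: cutoffs_is_cutoff.
apply/ler_addgt0Pr => e e0; rewrite -lerBlDr -[leLHS](@ulim_cst R).
apply: ulim_le => //; first exact: bounded_seq_cst.
near=> n; rewrite E; apply: ltW; near: n; exact: cutoffs_mass_near.
Unshelve. all: by end_near. Qed.

(** The function c + c' - c c' is again a cutoff, so two cutoffs of mass
close to 1 almost coincide in mean. *)
Lemma cutoff_union c c' : is_cutoff c -> is_cutoff c' ->
  weighted (fun x => c x + c' x - c x * c' x) <= 1.
Proof.
move=> [ccs c01] [ccs' c01']; apply: weighted_cutoff_le1; split.
  apply: csB; [exact: csD|apply: csM => //; exact: ccs'.1].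
move=> x; have /andP[? ?] := c01 x; have /andP[? ?] := c01' x.
by apply/andP; split; nra.
Qed.

(** Translating [f] amounts to translating the cutoff [c] backwards into
[c'], up to the factor [C]; by [cutoff_union], replacing [c'] by [c] costs at
most sup f times 1 - weighted c, which tends to 0. *)
Lemma mean_fun_translate_le g (C : R) f : (forall x, v (g * x)%g <= C * v x) ->
    bounded_continuous f -> (forall x, 0 <= f x) ->
  mean_fun (translate g f) <= C * mean_fun f.
Proof.
move=> vC fb f0; have [_ [B hB]] := fb.
have B0 : 0 <= B by exact: le_trans (hB 1%g).
have C0 : 0 < C.
  have := vC 1%g; rewrite ltNge; have := v_gt0 1%g; have := v_gt0 (g * 1)%g.
  move=> ? ? ?; apply/negP => C0; nra.
have tfb := truncated_bounded fb.
apply/ler_addgt0Pr => e e0.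
have be := bounded_seq_cst e.
rewrite -(@ulim_cst R e) -ulimDZ//; apply: ulim_le.
- by apply: truncated_bounded; exact: bc_translate.
- exact: bounded_seqDZ.
near=> n.
pose c := cutoffs n; pose c' := translate g^-1%g c.
have cc : is_cutoff c by exact: cutoffs_is_cutoff.
have cc' : is_cutoff c'.
  by split; [exact/cs_translate/cutoffs_cs|move=> x; exact: cutoffs01].
have ccs := cc.1; have ccs' := cc'.1.
have fc'cs : compactly_supported (fun x => f x * c' x).
  rewrite (_ : (fun x => _) = fun x => c' x * f x); first exact: csM ccs' fb.1.
  by apply/funext => x; rewrite mulrC.
have c0' x : 0 <= c' x by have /andP[] := cc'.2 x.
have fccs := bc_mul_cutoffs n fb.
rewrite /truncated -/c.
have -> : (fun x => translate g f x * c x) = translate g (fun x => f x * c' x).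
  by apply/funext => x; rewrite /c' /translate invgK mulVKg.
apply: le_trans (weighted_translate_le vC _) _.
  by split=> // x; rewrite mulr_ge0.
have c'1c : compactly_supported (fun x => c' x + -1 * (c' x * c x)).
  by apply: csD => //; apply: csZ; apply: csM => //; exact: ccs.1.
have h1 : weighted (fun x => f x * c' x) <=
    weighted (fun x => f x * c x) + B * (1 - weighted c).
  apply: (@le_trans _ _
    (weighted (fun x => B * (c' x + -1 * (c' x * c x)) + f x * c x))).
    apply: weighted_le => //; first by apply: csD => //; exact: csZ.
    move=> x; have := hB x; rewrite ger0_norm// => fB.
    have /andP[? ?] := cc'.2 x; have /andP[? ?] := cc.2 x; have := f0 x => ?.
    have : 0 <= (B - f x) * (c' x * (1 - c x)) by rewrite !mulr_ge0// subr_ge0.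
    have : 0 <= f x * (c x * (1 - c' x)) by rewrite !mulr_ge0// subr_ge0.
    by nra.
  rewrite weightedDZ// addrC lerD2l ler_wpM2l// lerBrDr -weightedD//.
  have := cutoff_union cc' cc; rewrite (_ : (fun x => _ - _) =
    fun x => c' x + -1 * (c' x * c x) + c x)//.
  by apply/funext => x; ring.
have hm : 1 - weighted c <= e / (C * (B + 1)).
  rewrite /c lerBlDr addrC -lerBlDr; apply: ltW; near: n; apply: cutoffs_mass_near.
  by rewrite divr_gt0// mulr_gt0// ltr_wpDl.
apply: le_trans (ler_wpM2l (ltW C0) h1) _.
rewrite mulrDr lerD2l mulrA.
have CB0 : 0 < C * (B + 1) by rewrite mulr_gt0// ltr_wpDl.
have c1 : 0 <= 1 - weighted c by rewrite subr_ge0 weighted_cutoff_le1.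
move: hm; rewrite ler_pdivlMr// => hm.
by nra.
Unshelve. all: by end_near. Qed.

Lemma mean_fun_translate_bound g : exists C : R, forall f,
  bounded_continuous f -> (forall x, 0 <= f x) ->
  mean_fun (translate g f) <= C * mean_fun f.
Proof.
by have [C hC] := v_le g; exists C => f; exact: mean_fun_translate_le.
Qed.

Lemma mean_fun_translate_near (e : R) : 0 < e ->
  \forall h \near (1%g : G), forall f,
    bounded_continuous f -> (forall x, 0 <= f x) ->
    `|mean_fun (translate h f) - mean_fun f| <= e * mean_fun f.
Proof.
move=> e0; have n1 := v_near e0; have n2 := near1_inv n1.
apply: filterS2 n1 n2 => g vg vgi f fb f0.
have h1 := mean_fun_translate_le vg fb f0.
have tb := bc_translate g fb.
have tf0 x : 0 <= translate g f x by exact: f0.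
have := mean_fun_translate_le vgi tb tf0.
rewrite translateM mulVg translate1 => h2.
have m0 := mean_fun_ge0 fb f0.
rewrite ler_norml; apply/andP; split; last by lra.
have [|h3] := leP (mean_fun f) (mean_fun (translate g f)); first by nra.
by nra.
Qed.

Definition weighted_mean : quasi_invariant_mean R G :=
  Mean mean_funDZ mean_fun_ge0 mean_fun1 mean_fun_translate_bound
    mean_fun_translate_near.

Lemma weighted_mean_cutoffs (e : R) : 0 < e ->
  exists n, 1 - e < weighted_mean (cutoffs n).
Proof.
move=> e0; have [m _ hm] := cutoffs_mass_near e0.
have {}hm := hm m (leqnn m).
exists m; apply: lt_le_trans hm _; rewrite /=.
have cb := cs_bc (cutoffs_cs m).
apply/ler_addgt0Pr => d d0; rewrite -lerBlDr -[leLHS](@ulim_cst R).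
apply: ulim_le; [exact: bounded_seq_cst|exact: truncated_bounded|].
near=> n.
have cm := cutoffs_is_cutoff m; have cn := cutoffs_is_cutoff n.
have := cutoff_union cm cn.
have mn := csM cm.1 cn.1.1.
rewrite (_ : (fun x => _ - _) = fun x => -1 * (cutoffs m x * cutoffs n x) +
    (cutoffs m x + cutoffs n x)); last by apply/funext => x; ring.
rewrite weightedDZ//; last exact: csD cm.1 cn.1.
rewrite weightedD; [|exact: cm.1|exact: cn.1].
have : 1 - d < weighted (cutoffs n) by near: n; exact: cutoffs_mass_near.
rewrite -/(truncated (cutoffs m) n); lra.
Unshelve. all: by end_near. Qed.

(** The translates of a compact set [B] that meet a compact set [A] are
those by elements of the compact set A B^-1, which is not all of the group. *)
Lemma cutoffs_escape : ~ compact [set: G] -> forall m n, exists g, forall x,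
  translate g (cutoffs n) x * cutoffs m x = 0.
Proof.
move=> ncG m n; have [_ [A cA fA]] := cutoffs_cs m.
have [_ [B cB fB]] := cutoffs_cs n.
have opc : continuous (fun p : G * G => (p.1 * p.2)%g) by exact: mulg_continuous.
have cAB := compact_image2 opc cA (compact_inv cB).
have [g hg] : exists g, ~ [set (x * y)%g | x in A & y in [set (y^-1)%g | y in B]] g.
  apply: contrapT => h; apply: ncG; move: cAB; congr compact.
  apply/seteqP; split=> // g _; apply: contrapT => hg; apply: h.
  by exists g.
exists g => x; have [Ax|nAx] := pselect (A x); last by rewrite fA// mulr0.
rewrite /translate fB ?mul0r// => Bx; apply: hg.
exists x => //; exists (g^-1 * x)^-1%g; first by exists (g^-1 * x)%g.
by rewrite /= invgM invgK mulVKg.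
Qed.

End WeightedMean.

(** * The Hilbert space of a positive semidefinite kernel *)

Record pdkernel (R : realType) (X : Type) := PDKernel {
  kernel_fun :> X -> X -> R ;
  kernel_sym : forall x y, kernel_fun x y = kernel_fun y x ;
  kernel_psd : forall l, 0 <= comb (fun x => comb (kernel_fun x) l) l }.

(** The quadratic is maximal at t = a / b. *)
Lemma le_sqr_of_quadratic (R : realType) (a b M : R) : 0 <= b ->
  (forall t, t * (2 * a) - t ^+ 2 * b <= M) -> a ^+ 2 <= M * b.
Proof.
move=> b0 h.
have M0 : 0 <= M by have := h 0; rewrite mul0r expr0n mul0r subr0.
have [b_eq0|bn0] := eqVneq b 0.
  have [->|an0] := eqVneq a 0; first by rewrite expr0n mulr_ge0.
  have := h ((M + 1) / (2 * a)).
  rewrite b_eq0 mulr0 subr0 divfK ?mulf_neq0 ?pnatr_eq0// => ?; exfalso; lra.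
have bgt0 : 0 < b by rewrite lt_neqAle eq_sym bn0.
have := h (a / b); rewrite [X in X <= M](_ : _ = a ^+ 2 / b); last by field.
by rewrite ler_pdivrMr.
Qed.

Lemma le_of_sqr (R : realType) (x y : R) : x ^+ 2 <= y ^+ 2 -> 0 <= y -> x <= y.
Proof. by move=> h y0; rewrite leNgt; apply/negP => xy; nra. Qed.

Lemma lt_of_sqr (R : realType) (x y : R) : x ^+ 2 < y ^+ 2 -> 0 <= y -> x < y.
Proof. by move=> h y0; rewrite ltNge; apply/negP => xy; nra. Qed.

Section KernelForm.
Context {R : realType} {X : Type} (K : pdkernel R X).
Implicit Types (f g : X -> R) (l m : seq (R * X)) (t : R).

Definition kform l m : R := comb (fun x => comb (K x) m) l.

Lemma kform_ge0 l : 0 <= kform l l. Proof. exact: kernel_psd. Qed.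

Lemma kform_sym l m : kform l m = kform m l.
Proof.
rewrite /kform /comb; under eq_bigr do rewrite mulr_sumr.
rewrite exchange_big; apply: eq_bigr => p _; rewrite mulr_sumr.
by apply: eq_bigr => q _; rewrite kernel_sym mulrCA.
Qed.

Lemma kform_catl l l' m : kform (l ++ l') m = kform l m + kform l' m.
Proof. exact: comb_cat. Qed.

Lemma kform_catr l m m' : kform l (m ++ m') = kform l m + kform l m'.
Proof. by rewrite kform_sym kform_catl !(kform_sym l). Qed.

Lemma kform_scalel t l m : kform (scale_comb t l) m = t * kform l m.
Proof. exact: comb_scale. Qed.

Lemma kform_scaler t l m : kform l (scale_comb t m) = t * kform l m.
Proof. by rewrite kform_sym kform_scalel kform_sym. Qed.

(** [f] is viewed as a linear functional on the combinations, with the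
seminorm given by [kform]. Its squared norm is the supremum over [l] of
2 f(l) - k(l, l); unlike the quotients f(l)^2 / k(l, l), these expressions are
defined everywhere and behave well under shifts of [l]. *)
Definition rk_le f M := forall l, 2 * comb f l - kform l l <= M.

Lemma rk_le_sqr f M l : rk_le f M -> comb f l ^+ 2 <= M * kform l l.
Proof.
move=> fM; apply: le_sqr_of_quadratic => [|t]; first exact: kform_ge0.
apply: le_trans (fM (scale_comb t l)).
by rewrite comb_scale kform_scalel kform_scaler; lra.
Qed.

Lemma rk_le_of_sqr f N : 0 <= N ->
  (forall l, comb f l ^+ 2 <= N * kform l l) -> rk_le f N.
Proof.
move=> N0 h l; have := h l; move: (kform_ge0 l).
move: (kform l l) (comb f l) => b a b0 {}h.
have := sqr_ge0 (b - N) => bN; rewrite leNgt; apply/negP => h'.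
have : (b + N) ^+ 2 < (2 * a) ^+ 2.
  by rewrite ltr_pXn2r// ?nnegrE ?addr_ge0//; lra.
by nra.
Qed.

Lemma rk_leZ t f M : rk_le f M -> rk_le (fun x => t * f x) (t ^+ 2 * M).
Proof.
move=> fM.
have M0 : 0 <= M by have := fM [::]; rewrite /kform !comb_nil; lra.
apply: rk_le_of_sqr => [|l]; first by rewrite mulr_ge0 ?sqr_ge0.
by rewrite combZ exprMn -(mulrA (t ^+ 2) M) ler_wpM2l ?sqr_ge0// rk_le_sqr.
Qed.

Lemma rk_leD f g a b : 0 <= a -> 0 <= b -> rk_le f (a ^+ 2) ->
  rk_le g (b ^+ 2) -> rk_le (fun x => f x + g x) ((a + b) ^+ 2).
Proof.
move=> a0 b0 fa gb l; rewrite combD.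
have := rk_le_sqr l fa; have := rk_le_sqr l gb.
rewrite -(sqr_sqrtr (kform_ge0 l)); set s := Num.sqrt _.
have s0 : 0 <= s by exact: sqrtr_ge0.
rewrite -!exprMn => /le_of_sqr/(_ (mulr_ge0 b0 s0)) hg.
move=> /le_of_sqr/(_ (mulr_ge0 a0 s0)) hf.
have := sqr_ge0 (a + b - s); nra.
Qed.

End KernelForm.

(** The reproducing kernel Hilbert space is realised as the space of
bounded functionals, that is as a dual. Completeness is then immediate, and the
kernel functions span a dense subspace by [kernel_comb_dense]. *)
Definition rk_bounded (R : realType) (X : Type) (K : pdkernel R X) :
  {pred X -> R} := fun f => `[< exists M, rk_le K f M >].

Record rkhs (R : realType) (X : Type) (K : pdkernel R X) := RKHS {
  rk_fun :> X -> R ; rk_funP : rk_fun \in rk_bounded K }.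

Section Instances.
Context {R : realType} {X : Type} (K : pdkernel R X).

HB.instance Definition _ := [isSub for @rk_fun R X K].
HB.instance Definition _ := [Choice of rkhs K by <:].

Lemma rk_le_sqrt (f : X -> R) M : rk_le K f M -> rk_le K f (Num.sqrt M ^+ 2).
Proof.
move=> fM; rewrite sqr_sqrtr//; have := fM [::].
by rewrite /kform !comb_nil mulr0 subr0.
Qed.

Lemma rk_bounded_submod : submod_closed (rk_bounded K).
Proof.
split; first by apply/asboolP; exists 0 => l; have := kform_ge0 K l;
  rewrite (_ : comb _ l = 0) ?mulr0; [lra|rewrite /comb big1// => p _; rewrite mulr0].
move=> t f g /asboolP[M /(rk_leZ t)/rk_le_sqrt fM] /asboolP[N /rk_le_sqrt gN].
by apply/asboolP; eexists; apply: rk_leD fM gN; exact: sqrtr_ge0.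
Qed.

HB.instance Definition _ :=
  GRing.isSubmodClosed.Build R (X -> R) (rk_bounded K) rk_bounded_submod.
HB.instance Definition _ := [SubChoice_isSubLmodule of rkhs K by <:].

End Instances.

Section Norm.
Context {R : realType} {X : Type} (K : pdkernel R X).
Implicit Types (f g : rkhs K) (l m : seq (R * X)) (t : R).

Lemma rk_addE f g x : (f + g) x = f x + g x. Proof. by []. Qed.
Lemma rk_oppE f x : (- f) x = - f x. Proof. by []. Qed.
Lemma rk_ext f g : (forall x, f x = g x) -> f = g.
Proof. by move=> h; apply: val_inj; apply/funext. Qed.

Definition rk_energy f : R :=
  sup [set e | exists l, e = 2 * comb f l - kform K l l].

Lemma rk_energy_le f : rk_le K f (rk_energy f).
Proof.
have /asboolP[M fM] := rk_funP f.
by move=> l; apply: ub_le_sup; [exists M => _ [m ->]; exact: fM|exists l].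
Qed.

Lemma rk_energy_min f M : rk_le K f M -> rk_energy f <= M.
Proof.
move=> fM; apply: ge_sup => [|_ [l ->]]; last exact: fM.
by exists (2 * comb f [::] - kform K [::] [::]), [::].
Qed.

Lemma rk_energy_ge0 f : 0 <= rk_energy f.
Proof. by have := rk_energy_le f [::]; rewrite /kform !comb_nil mulr0 subr0. Qed.

Definition rk_norm f : R := Num.sqrt (rk_energy f).

Lemma rk_norm_ge0 f : 0 <= rk_norm f. Proof. exact: sqrtr_ge0. Qed.

Lemma rk_norm_sqr f : rk_norm f ^+ 2 = rk_energy f.
Proof. by rewrite sqr_sqrtr// rk_energy_ge0. Qed.

Lemma rk_norm_le f a : 0 <= a -> rk_le K f (a ^+ 2) -> rk_norm f <= a.
Proof.
by move=> a0 fa; apply: le_of_sqr => //; rewrite rk_norm_sqr rk_energy_min.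
Qed.

Lemma rk_leN f : rk_le K f (rk_norm f ^+ 2).
Proof. by rewrite rk_norm_sqr; exact: rk_energy_le. Qed.

Lemma rk_ler_normD f g : rk_norm (f + g) <= rk_norm f + rk_norm g.
Proof.
apply: rk_norm_le; first by rewrite addr_ge0 ?rk_norm_ge0.
by apply: rk_leD; rewrite ?rk_norm_ge0//; exact: rk_leN.
Qed.

Lemma rk_normrZ_le t f : rk_norm (t *: f) <= `|t| * rk_norm f.
Proof.
apply: rk_norm_le; first by rewrite mulr_ge0 ?rk_norm_ge0.
by rewrite exprMn -normrX (ger0_norm (sqr_ge0 t)); apply/rk_leZ/rk_leN.
Qed.

Lemma rk_normrZ t f : rk_norm (t *: f) = `|t| * rk_norm f.
Proof.
apply/eqP; rewrite eq_le rk_normrZ_le /=.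
have [->|t0] := eqVneq t 0; first by rewrite normr0 mul0r rk_norm_ge0.
rewrite -ler_pdivlMl ?normr_gt0// -normfV.
by have := rk_normrZ_le t^-1 (t *: f); rewrite scalerA mulVf// scale1r.
Qed.

Lemma rk_norm0_eq0 f : rk_norm f = 0 -> f = 0.
Proof.
move=> f0; apply: rk_ext => x.
have := rk_le_sqr [:: (1, x)] (@rk_leN f).
rewrite f0 expr0n mul0r comb1 mul1r => h; apply/eqP.
by rewrite -sqrf_eq0 eq_le h sqr_ge0.
Qed.

HB.instance Definition _ := Lmodule_isNormed.Build R (rkhs K)
  rk_ler_normD rk_normrZ rk_norm0_eq0.

Lemma rk_normE f : `|f| = rk_norm f. Proof. by []. Qed.

Lemma comb_le_norm f l : comb f l ^+ 2 <= `|f| ^+ 2 * kform K l l.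
Proof. exact/rk_le_sqr/rk_leN. Qed.

Lemma rk_eval_le f x : `|f x| <= `|f| * Num.sqrt (K x x).
Proof.
have := comb_le_norm f [:: (1, x)]; rewrite /kform !comb1 !mul1r => h.
have k0 : 0 <= K x x by have := kform_ge0 K [:: (1, x)]; rewrite /kform !comb1 !mul1r.
apply: le_of_sqr; last by rewrite mulr_ge0 ?sqrtr_ge0.
by rewrite exprMn (sqr_sqrtr k0) -normrX ger0_norm ?sqr_ge0.
Qed.

End Norm.

Section Complete.
Context {R : realType} {X : Type} (K : pdkernel R X).
Implicit Types (f g : rkhs K).

(** Evaluations are continuous, so a Cauchy filter converges pointwise,
and the inequalities that define the norm pass to the limit. *)
Lemma rk_complete (F : set_system (rkhs K)) :
  ProperFilter F -> cauchy F -> cvg F.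
Proof.
move=> PF /cauchyP Fc.
have Fd (e : R) : 0 < e -> exists2 f0 : rkhs K, F [set f | `|f0 - f| < e] & True.
  by move=> e0; have [f0 h] := Fc _ e0; exists f0 => //; move: h; rewrite -ball_normE.
have ev_cvg x : cvg ((fun f : rkhs K => f x) @ F).
  apply: cauchy_cvg; apply/cauchyP => e e0.
  have s0 : 0 < Num.sqrt (K x x) + 1 by rewrite ltr_wpDl ?sqrtr_ge0.
  have [f0 Ff _] := Fd _ (divr_gt0 e0 s0).
  exists (f0 x); change (F [set f : rkhs K | ball (f0 x) e (f x)]).
  apply: filterS Ff => f /=; rewrite ltr_pdivlMr// => h.
  rewrite -ball_normE /ball_/=.
  apply: le_lt_trans h; rewrite -rk_oppE -rk_addE.
  apply: le_trans (rk_eval_le _ _) _.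
  by rewrite ler_wpM2l// lerDl ler01.
pose phi x := lim ((fun f : rkhs K => f x) @ F).
have combF l : (fun f : rkhs K => comb f l) @ F --> comb phi l.
  rewrite /comb.
  elim: l => [|p l IH].
    by rewrite big_nil; under eq_fun do rewrite big_nil; exact: cvg_cst.
  rewrite big_cons; under eq_fun do rewrite big_cons.
  apply: cvgD => //; apply: cvgM; [exact: cvg_cst|exact: ev_cvg].
have phiF (f0 : rkhs K) (e : R) : 0 < e -> F [set f | `|f0 - f| < e] ->
    rk_le K (fun x => f0 x - phi x) (e ^+ 2).
  move=> e0 Ff l.
  have lim_l : (fun f : rkhs K => 2 * comb (f0 - f) l - kform K l l) @ F -->
      2 * comb (fun x => f0 x - phi x) l - kform K l l.
    apply: cvgB; last exact: cvg_cst.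
    apply: cvgM; first exact: cvg_cst.
    rewrite combB; under eq_fun do rewrite (combB f0).
    by apply: cvgB; [exact: cvg_cst|exact: combF].
  apply: (cvg_ler lim_l).
  apply: filterS Ff => f /= h; apply: (le_trans (rk_leN (f0 - f) l)).
  by rewrite ler_pXn2r ?nnegrE ?rk_norm_ge0 ?ltW.
have [f1 Ff1 _] := Fd 1 ltr01.
have phib : phi \in rk_bounded K.
  have d1 : (fun x => f1 x - phi x) \in rk_bounded K.
    by apply/asboolP; exists (1 ^+ 2); exact: phiF.
  rewrite (_ : phi = rk_fun f1 - (fun x => f1 x - phi x)); last first.
    by apply/funext => x; rewrite !fctE subKr.
  by apply: rpredB => //; exact: rk_funP.
apply/cvg_ex; exists (RKHS phib); apply/cvgrPdist_lt => e e0.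
have e20 : 0 < e / 2 by rewrite divr_gt0.
have e40 : 0 < e / 4 by rewrite divr_gt0.
have [f0 Ff0 _] := Fd _ e40.
have h0 : `|f0 - RKHS phib| <= e / 4.
  by apply: rk_norm_le (ltW e40) _; exact: phiF.
apply: filterS Ff0 => f /= hf.
have -> : RKHS phib - f = - (f0 - RKHS phib) + (f0 - f).
  by rewrite opprB addrA subrK.
by apply: le_lt_trans (ler_normD _ _) _; rewrite normrN; lra.
Qed.

HB.instance Definition _ := Uniform_isComplete.Build (rkhs K) rk_complete.

End Complete.

Section Polarization.
Context {R : realType} {V : normedModType R}.
Implicit Types (f g : V) (t : R).

(** The only possible inner product of a Hilbert norm. *)
Definition polar f g : R := (`|f + g| ^+ 2 - `|f - g| ^+ 2) / 4.

Lemma polarC f g : polar f g = polar g f.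
Proof. by rewrite /polar (addrC f) distrC. Qed.

Lemma polar_self f : polar f f = `|f| ^+ 2.
Proof.
have -> : polar f f = (`|2 *: f| ^+ 2 - `|0 : V| ^+ 2) / 4.
  by rewrite /polar subrr scaler_nat.
by rewrite normrZ normr0 ger0_norm// exprMn; field.
Qed.

Lemma polar_continuous f : continuous (polar f).
Proof.
have sq (u : V -> V) (g : V) : u h @[h --> g] --> u g ->
    `|u h| ^+ 2 @[h --> g] --> `|u g| ^+ 2.
  by move=> /cvg_norm ug; exact: (cvgM ug ug).
move=> g; apply: cvgM; last exact: cvg_cst.
apply: cvgB.
  by apply: (sq (fun h => f + h)); apply: cvgD; [exact: cvg_cst|exact: cvg_id].
by apply: (sq (fun h => f - h)); apply: cvgB; [exact: cvg_cst|exact: cvg_id].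
Qed.

(** By continuity, linearity in the first variable need only be checked
when the second one runs through a dense set. *)
Lemma polarDZl_dense (D : set V) t f f' g :
    (forall h (e : R), 0 < e -> exists2 d, D d & `|h - d| < e) ->
    (forall d, D d -> polar (t *: f + f') d = t * polar f d + polar f' d) ->
  polar (t *: f + f') g = t * polar f g + polar f' g.
Proof.
move=> dD eqD; pose d g := polar (t *: f + f') g - (t * polar f g + polar f' g).
have dc : continuous d.
  move=> h; apply: cvgB; first exact: polar_continuous.
  apply: cvgD; last exact: polar_continuous.
  by apply: cvgM; [exact: cvg_cst|exact: polar_continuous].
apply/eqP; rewrite -subr_eq0 -/(d g) -normr_eq0 eq_le normr_ge0 andbT.
apply/ler_addgt0Pl => e e0; rewrite addr0; apply: ltW.
have /cvgrPdist_lt/(_ e e0)/nbhs_normP[r /= r0 hr] := dc g.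
have [h Dh hl] := dD g r r0.
by have := hr _ hl; rewrite /= /d (eqD h Dh) subrr subr0.
Qed.

End Polarization.

Section InnerProduct.
Context {R : realType} {X : Type} (K : pdkernel R X).
Implicit Types (f g : rkhs K) (l m : seq (R * X)) (t : R).

Lemma kernel_comb_le l : rk_le K (fun x => comb (K x) l) (kform K l l).
Proof.
move=> m; have := kform_ge0 K (m ++ scale_comb (-1) l).
rewrite kform_catl !kform_catr !kform_scalel !kform_scaler (kform_sym K l m).
by rewrite -/(kform K m l); lra.
Qed.

Lemma kernel_comb_bounded l : (fun x => comb (K x) l) \in rk_bounded K.
Proof. by apply/asboolP; eexists; exact: kernel_comb_le. Qed.

(** The functional represented by the combination [l]. *)
Definition kernel_comb l : rkhs K := RKHS (kernel_comb_bounded l).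

Lemma comb_kernel_comb l m : comb (kernel_comb l) m = kform K m l.
Proof. by []. Qed.

Lemma kernel_comb_cat l m :
  kernel_comb (l ++ m) = kernel_comb l + kernel_comb m.
Proof. by apply: rk_ext => x; exact: comb_cat. Qed.

Lemma kernel_comb_scale t l :
  kernel_comb (scale_comb t l) = t *: kernel_comb l.
Proof. by apply: rk_ext => x; exact: comb_scale. Qed.

Lemma rk_energyE f : rk_energy f = `|f| ^+ 2.
Proof. by rewrite rk_normE rk_norm_sqr. Qed.

Lemma sqr_normB_kernel_comb_le f l :
  `|f - kernel_comb l| ^+ 2 <= `|f| ^+ 2 - 2 * comb f l + kform K l l.
Proof.
rewrite -!rk_energyE; apply: rk_energy_min => m.
rewrite (combB f (kernel_comb l)) comb_kernel_comb.
have := rk_energy_le f (m ++ l).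
by rewrite kform_catl !kform_catr comb_cat (kform_sym K l m); lra.
Qed.

(** The substitution m := m + l in the supremum that defines the norm of
[f]. The right-hand side says that [l] approximates [f] as well as it
approaches that supremum, whence density; and the same identity for - l gives the
inner product of [f] with a kernel function. *)
Lemma sqr_normB_kernel_comb f l :
  `|f - kernel_comb l| ^+ 2 = `|f| ^+ 2 - 2 * comb f l + kform K l l.
Proof.
apply/eqP; rewrite eq_le sqr_normB_kernel_comb_le /=.
have := sqr_normB_kernel_comb_le (f - kernel_comb l) (scale_comb (-1) l).
rewrite kernel_comb_scale scaleN1r opprK subrK kform_scalel !kform_scaler.
rewrite comb_scale (combB f (kernel_comb l)) comb_kernel_comb.
by lra.
Qed.

(** Take [l] for which 2 f(l) - k(l, l) almost attains its supremum. *)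
Lemma kernel_comb_dense f (e : R) : 0 < e -> exists l, `|f - kernel_comb l| < e.
Proof.
move=> e0; have e20 : 0 < e ^+ 2 by rewrite exprn_gt0.
have hs : has_sup [set x | exists l, x = 2 * comb f l - kform K l l].
  split; first by exists (2 * comb f [::] - kform K [::] [::]), [::].
  by exists (rk_energy f) => _ [l ->]; exact: rk_energy_le.
have [_ [l ->] hl] := sup_adherent e20 hs.
exists l; rewrite ltNge; apply/negP => h.
have : e ^+ 2 <= `|f - kernel_comb l| ^+ 2 by rewrite ler_pXn2r ?nnegrE// ltW.
rewrite sqr_normB_kernel_comb -rk_energyE; move: hl; rewrite -/(rk_energy f).
lra.
Qed.

Definition rk_dot f g : R := polar f g.

Lemma rk_dot_kernel_comb f l : rk_dot f (kernel_comb l) = comb f l.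
Proof.
have h := sqr_normB_kernel_comb f l.
have := sqr_normB_kernel_comb f (scale_comb (-1) l).
rewrite kernel_comb_scale scaleN1r opprK comb_scale kform_scalel kform_scaler.
by move=> h'; rewrite /rk_dot /polar h h'; field.
Qed.

Lemma rk_dotDZl t f f' g : rk_dot (t *: f + f') g = t * rk_dot f g + rk_dot f' g.
Proof.
apply: (polarDZl_dense (D := range kernel_comb)) => [h e e0|_ [l _ <-]].
  by have [l hl] := kernel_comb_dense h e0; exists (kernel_comb l) => //; exists l.
by rewrite -!/(rk_dot _ _) !rk_dot_kernel_comb combD combZ.
Qed.

Lemma rk_dot_bilinear :
  bilinear_for ( *%R : R -> R -> R) ( idfun \; *%R : R -> R -> R) rk_dot.
Proof.
split=> [f' t f g|f t g g'] /=; first exact: rk_dotDZl.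
by rewrite /rk_dot polarC -/(rk_dot _ _) rk_dotDZl !(polarC f).
Qed.

HB.instance Definition _ := bilinear_isBilinear.Build R (rkhs K) (rkhs K) R
   _ _ rk_dot rk_dot_bilinear.

Lemma rk_dot_hermitian f g : rk_dot f g = (-1) ^+ false * idfun (rk_dot g f).
Proof. by rewrite expr0 mul1r /= /rk_dot polarC. Qed.

HB.instance Definition _ := isHermitianSesquilinear.Build R (rkhs K) false idfun
  rk_dot rk_dot_hermitian.

Lemma rk_dot_gt0 f : f != 0 -> 0 < rk_dot f f.
Proof. by move=> f0; rewrite /rk_dot polar_self exprn_gt0// normr_gt0. Qed.

HB.instance Definition _ := isDotProduct.Build R (rkhs K) rk_dot rk_dot_gt0.

Lemma rkhs_hilbert : hilbert_space (rkhs K).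
Proof. by exists rk_dot => f; rewrite /= /rk_dot polar_self. Qed.

Lemma kernel_comb_cons t x l :
  kernel_comb ((t, x) :: l) = t *: kernel_comb [:: (1, x)] + kernel_comb l.
Proof.
rewrite -kernel_comb_scale -kernel_comb_cat /= /scale_comb /=.
by rewrite mulr1.
Qed.

Lemma sqr_norm_kernel_comb l : `|kernel_comb l| ^+ 2 = kform K l l.
Proof.
have := sqr_normB_kernel_comb (kernel_comb l) l.
by rewrite subrr normr0 expr0n comb_kernel_comb /=; lra.
Qed.

Lemma sqr_dist_kernel x y :
  `|kernel_comb [:: (1, x)] - kernel_comb [:: (1, y)]| ^+ 2
    = K x x - 2 * K x y + K y y.
Proof.
have k1 a b : kform K [:: (1, a)] [:: (1, b)] = K a b.
  by rewrite /kform !comb1 !mul1r.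
have h := sqr_normB_kernel_comb (kernel_comb [:: (1, x)]) [:: (1, y)].
rewrite h sqr_norm_kernel_comb comb_kernel_comb !k1.
by rewrite (kernel_sym K y x).
Qed.

Lemma rkhs_separable (s : nat -> X) :
    (forall x e, 0 < e ->
      exists n, K x x - 2 * K x (s n) + K (s n) (s n) < e) ->
  separable_space (rkhs K).
Proof.
move=> sd; pose r (c : seq (rat * nat)) := [seq (ratr p.1 : R, s p.2) | p <- c].
exists (range (fun c => kernel_comb (r c))).
  by apply: card_le_trans (card_image_le _ _) _; exact: countableP.
have rat_comb l (e : R) : 0 < e ->
    exists c, `|kernel_comb l - kernel_comb (r c)| < e.
  elim: l e => [|[t x] l IH] e e0; first by exists [::]; rewrite subrr normr0.
  have e30 : 0 < e / 3 by rewrite divr_gt0.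
  have [c hc] := IH _ e30.
  pose k y := kernel_comb [:: (1, y)].
  have [n hn] : exists n, `|t| * `|k x - k (s n)| < e / 3.
    have u0 : 0 < e / 3 / (`|t| + 1) by rewrite divr_gt0// ltr_wpDl.
    have [n hn] := sd x _ (exprn_gt0 2 u0); exists n.
    have hk : `|k x - k (s n)| < e / 3 / (`|t| + 1).
      apply: lt_of_sqr (ltW u0); apply: le_lt_trans hn.
      by rewrite sqr_dist_kernel.
    rewrite ltr_pdivlMr in hk; last by rewrite ltr_wpDl.
    by apply: le_lt_trans hk; rewrite mulrC ler_wpM2l// lerDl.
  have [q hq] : exists q : rat, `|t - ratr q| * `|k (s n)| < e / 3.
    have u0 : 0 < e / 3 / (`|k (s n)| + 1) by rewrite divr_gt0// ltr_wpDl.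
    have [q] := @rat_in_itvoo R _ _ (ltr_pwDr u0 (lexx t)).
    rewrite in_itv/= => /andP[q1 q2]; exists q.
    have : `|t - ratr q| < e / 3 / (`|k (s n)| + 1).
      by rewrite distrC gtr0_norm; lra.
    rewrite ltr_pdivlMr; last by rewrite ltr_wpDl.
    by apply: le_lt_trans; rewrite ler_wpM2l// lerDl.
  exists ((q, n) :: c).
  rewrite (kernel_comb_cons t x l) (kernel_comb_cons (ratr q) (s n) (r c)).
  rewrite -/(k x) -/(k (s n)).
  have -> : t *: k x + kernel_comb l - (ratr q *: k (s n) + kernel_comb (r c))
      = t *: (k x - k (s n)) + (t - ratr q) *: k (s n)
        + (kernel_comb l - kernel_comb (r c)).
    by rewrite scalerBr scalerBl !addrA subrK opprD addrACA addrA.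
  apply: le_lt_trans (ler_normD _ _) _.
  have := ler_normD (t *: (k x - k (s n))) ((t - ratr q) *: k (s n)).
  by rewrite !normrZ; lra.
move=> O [f Of] oO.
have /nbhs_normP[e /= e0 he] : nbhs f O by exact: open_nbhs_nbhs.
have e20 : 0 < e / 2 by rewrite divr_gt0.
have [l hl] := kernel_comb_dense f e20.
have [c hc] := rat_comb l _ e20.
exists (kernel_comb (r c)); split; last by exists c.
apply: he => /=; rewrite -(subrK (kernel_comb l) f) -addrA.
by apply: le_lt_trans (ler_normD _ _) _; lra.
Qed.

End InnerProduct.

(** * The affine action attached to a mean *)

(** Maps that are equi-Lipschitz near the identity inherit continuity at
the identity from a dense set of vectors; the identity
[a g v = a (g g0^-1) (a g0 v)] then carries it to any point [(g0, v0)]. *)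
Lemma jointly_continuous_action (R : realType) (G : topologicalGroupType)
    (V : normedModType R) (a : G -> V -> V) (D : set V) :
    (forall g h v, a (g * h)%g v = a g (a h v)) ->
    (forall g, exists C : R, forall v w, `|a g v - a g w| <= C * `|v - w|) ->
    (exists C : R, \forall h \near (1%g : G),
       forall v w, `|a h v - a h w| <= C * `|v - w|) ->
    (forall v (e : R), 0 < e -> exists2 d, D d & `|v - d| < e) ->
    (forall d (e : R), D d -> 0 < e ->
       \forall h \near (1%g : G), `|a h d - d| < e) ->
  continuous (fun p : G * V => a p.1 p.2).
Proof.
move=> aM aL [C1 aL1] Dd aD.
pose C : R := `|C1| + 1.
have C0 : 0 < C by rewrite ltr_wpDl.
have CC (v : V) : C1 * `|v| <= C * `|v|.
  by rewrite ler_wpM2r// (le_trans (ler_norm _))// lerDl.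
have aV v (e : R) : 0 < e -> \forall h \near (1%g : G), `|a h v - v| < e.
  move=> e0; have e30 : 0 < e / 3 by rewrite divr_gt0.
  have [d Dd' vd] := Dd v _ (divr_gt0 e30 C0).
  have vd1 : `|v - d| < e / 3.
    apply: lt_le_trans vd _; rewrite ler_pdivrMr//.
    by have := normr_ge0 C1; rewrite /C; nra.
  near=> h.
  have -> : a h v - v = (a h v - a h d) + (a h d - d) + (d - v).
    by rewrite !addrA !subrK.
  have h1 : `|a h v - a h d| < e / 3.
    apply: le_lt_trans (le_trans _ (CC _)) _; first by near: h; apply: filterS aL1.
    by rewrite mulrC -ltr_pdivlMr.
  have h2 : `|a h d - d| < e / 3 by near: h; exact: aD.
  rewrite distrC in vd1.
  have := ler_normD (a h v - a h d + (a h d - d)) (d - v).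
  by have := ler_normD (a h v - a h d) (a h d - d); lra.
move=> [g0 v0] /=; apply/cvgrPdist_lt => e e0 /=.
have e20 : 0 < e / 2 by rewrite divr_gt0.
have [B aB] := aL g0; pose B' : R := `|B| + 1.
have B0 : 0 < B' by rewrite ltr_wpDl.
have u0 : 0 < e / 2 / C / B' by rewrite !divr_gt0.
have N1 := near1_divr g0 (aV (a g0 v0) _ e20).
have N2 : \forall v \near v0, `|v0 - v| < e / 2 / C / B'.
  by apply/nbhs_normP; exists (e / 2 / C / B').
near=> p.
have aE : a p.1 p.2 = a (p.1 * g0^-1)%g (a g0 p.2) by rewrite -aM mulgVK.
have h1 : `|a (p.1 * g0^-1)%g (a g0 v0) - a g0 v0| < e / 2.
  by near: p; exact: (cvg_fst N1).
have h2 : forall v w, `|a (p.1 * g0^-1)%g v - a (p.1 * g0^-1)%g w| <= C1 * `|v - w|.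
  by near: p; exact: (cvg_fst (near1_divr g0 aL1)).
have h3 : `|v0 - p.2| < e / 2 / C / B'.
  by near: p; exact: (cvg_snd N2).
rewrite aE distrC.
have -> : a (p.1 / g0)%g (a g0 p.2) - a g0 v0 =
   (a (p.1 / g0)%g (a g0 p.2) - a (p.1 / g0)%g (a g0 v0)) +
    (a (p.1 / g0)%g (a g0 v0) - a g0 v0) by rewrite addrA subrK.
apply: le_lt_trans (ler_normD _ _) _.
suff : `|a (p.1 / g0)%g (a g0 p.2) - a (p.1 / g0)%g (a g0 v0)| < e / 2 by lra.
apply: le_lt_trans (le_trans (h2 _ _) (CC _)) _.
rewrite mulrC -ltr_pdivlMr//; apply: le_lt_trans (aB _ _) _.
apply: (@le_lt_trans _ _ (`|p.2 - v0| * B')).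
  by rewrite mulrC ler_wpM2l// (le_trans (ler_norm _))// lerDl.
by rewrite -ltr_pdivlMr// distrC.
Unshelve. all: by end_near. Qed.

Section CovarianceKernel.
Context {R : realType} {G : topologicalGroupType}.
Variables (M : quasi_invariant_mean R G) (chi : nat -> G -> R).
Hypothesis chi_bc : forall n, bounded_continuous (chi n).
Hypothesis chi_luc : forall n, left_uniformly_continuous (chi n).
Implicit Types (x y : G * nat) (g h : G) (l m : seq (R * (G * nat))) (t : R).

(** The index (g, n) stands for the translate of [chi n] by [g], and a
combination of indices for the corresponding function. *)
Definition element x : G -> R := translate x.1 (chi x.2).

Definition function_of l : G -> R := fun z => comb (element ^~ z) l.

Lemma element_bc x : bounded_continuous (element x).
Proof. exact: bc_translate. Qed.

Lemma function_of_cons p l :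
  function_of (p :: l) = fun z => p.1 * element p.2 z + function_of l z.
Proof. by apply/funext => z; exact: big_cons. Qed.

Lemma function_of_nil : function_of [::] = fun=> 0.
Proof. by apply/funext => z; exact: big_nil. Qed.

Lemma function_of_bc l : bounded_continuous (function_of l).
Proof.
elim: l => [|p l IH]; first by rewrite function_of_nil; exact: bc_cst.
by rewrite function_of_cons; apply: bcD => //; apply/bcZ/element_bc.
Qed.

Lemma function_of_luc l : left_uniformly_continuous (function_of l).
Proof.
elim: l => [|p l IH]; first by rewrite function_of_nil; exact: luc_cst.
by rewrite function_of_cons; apply: lucD => //; apply/lucZ/luc_translate.
Qed.

Lemma mean_function_of_mul (f : G -> R) l : bounded_continuous f ->
  comb (fun x => M (fun z => f z * element x z)) l
    = M (fun z => f z * function_of l z).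
Proof.
move=> fb; elim: l => [|p l IH].
  rewrite comb_nil function_of_nil (@eq_mean _ _ M _ (fun=> 0)) ?mean_cst//.
  by move=> z; rewrite mulr0.
rewrite function_of_cons [LHS]big_cons [X in _ + X]IH.
have b1 := bcM fb (element_bc p.2); have b2 := bcM fb (function_of_bc l).
rewrite -(meanZ M p.1 b1) -(meanD M (bcZ p.1 b1) b2).
by apply: eq_mean => z; ring.
Qed.

Lemma mean_function_of l : comb (fun x => M (element x)) l = M (function_of l).
Proof.
have := mean_function_of_mul l (bc_cst 1).
rewrite (@eq_mean _ _ M (fun z => 1 * function_of l z) (function_of l)).
  move=> <-; apply: eq_bigr => p _; congr (_ * _).
  by apply: eq_mean => z; rewrite mul1r.
by move=> z; rewrite mul1r.
Qed.

Definition cov x y := covariance M (element x) (element y).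

Lemma cov_sym x y : cov x y = cov y x.
Proof.
rewrite /cov /covariance mulrC; congr (_ - _).
by apply: eq_mean => z; rewrite mulrC.
Qed.

Lemma comb_cov l m : comb (fun x => comb (cov x) m) l =
  covariance M (function_of l) (function_of m).
Proof.
have covE x : comb (cov x) m = covariance M (element x) (function_of m).
  rewrite /cov /covariance combB combZ mean_function_of.
  by rewrite (mean_function_of_mul _ (element_bc x)).
under [LHS]eq_bigr do rewrite covE.
rewrite -/(comb (fun x => covariance M (element x) (function_of m)) l).
rewrite /covariance combB; congr (_ - _).
  rewrite (@eq_mean _ _ M _ (fun z => function_of m z * function_of l z)).
    rewrite -mean_function_of_mul; last exact: function_of_bc.
    by apply: eq_bigr => p _; congr (_ * _); apply: eq_mean => z; exact: mulrC.
  by move=> z; exact: mulrC.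
rewrite [RHS]mulrC -(mean_function_of l) -combZ.
by apply: eq_bigr => p _; rewrite (mulrC (M (function_of m))).
Qed.

Lemma cov_psd l : 0 <= comb (fun x => comb (cov x) l) l.
Proof. by rewrite comb_cov; apply: variance_ge0; exact: function_of_bc. Qed.

Definition covariance_kernel : pdkernel R (G * nat) := PDKernel cov_sym cov_psd.

Local Notation K := covariance_kernel.
Local Notation H := (rkhs K).
Implicit Types (phi psi : H).

Lemma kform_cov l m :
  kform K l m = covariance M (function_of l) (function_of m).
Proof. exact: comb_cov. Qed.

Definition act_index g x : G * nat := ((g * x.1)%g, x.2).

Definition act_comb g l := [seq (p.1, act_index g p.2) | p <- l].

Lemma comb_act_comb (f : G * nat -> R) g l :
  comb f (act_comb g l) = comb (fun x => f (act_index g x)) l.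
Proof. exact: big_map. Qed.

Lemma element_act g x : element (act_index g x) = translate g (element x).
Proof. by rewrite /element translateM. Qed.

Lemma function_of_act g l :
  function_of (act_comb g l) = translate g (function_of l).
Proof.
apply/funext => z; rewrite /function_of comb_act_comb.
by apply: eq_bigr => p _; rewrite element_act.
Qed.

Definition quasi_invariance_bound g (C : R) := forall p,
  bounded_continuous p -> (forall z, 0 <= p z) -> M (translate g p) <= C * M p.

Lemma quasi_invariance_bound_ge0 g C : quasi_invariance_bound g C -> 0 <= C.
Proof.
move=> gC; have := gC (fun=> 1) (bc_cst 1) (fun=> ler01).
by rewrite /translate !mean1 mulr1; apply: le_trans.
Qed.

(** The functional phi o T_(g^-1), in terms of its values on indices. *)
Definition shift_fun g (f : G * nat -> R) : G * nat -> R :=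
  fun x => f (act_index g^-1%g x).

Lemma rk_le_shift g C (N : R) (f : G * nat -> R) :
    quasi_invariance_bound g^-1%g C -> rk_le K f N ->
  rk_le K (shift_fun g f) (N * C).
Proof.
move=> gC fN.
have C0 := quasi_invariance_bound_ge0 gC.
have N0 : 0 <= N.
  by have := fN [::]; rewrite /kform !comb_nil mulr0 subr0.
apply: rk_le_of_sqr; first exact: mulr_ge0.
move=> l; rewrite -comb_act_comb; apply: le_trans (rk_le_sqr _ fN) _.
rewrite -mulrA ler_wpM2l// !kform_cov function_of_act.
have := variance_translate_le (function_of_bc l) gC.
by apply: le_trans; rewrite lerDl sqr_ge0.
Qed.

Lemma rk_shift_bounded g (phi : H) : shift_fun g phi \in rk_bounded K.
Proof.
have [C gC] := mean_translate_le M g^-1%g.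
by apply/asboolP; eexists; apply: rk_le_shift gC (rk_leN _).
Qed.

Definition rk_shift g phi : H := RKHS (rk_shift_bounded g phi).

Lemma rk_shift_le g C phi : quasi_invariance_bound g^-1%g C ->
  `|rk_shift g phi| <= Num.sqrt C * `|phi|.
Proof.
move=> gC; have C0 := quasi_invariance_bound_ge0 gC.
apply: rk_norm_le; first by rewrite mulr_ge0 ?sqrtr_ge0.
rewrite exprMn sqr_sqrtr// mulrC; exact: rk_le_shift gC (rk_leN _).
Qed.

Lemma rk_shift_linear g : linear (rk_shift g).
Proof. by move=> t phi psi; apply: rk_ext => x. Qed.

HB.instance Definition _ g :=
  GRing.isLinear.Build R H H _ (rk_shift g) (rk_shift_linear g).

Lemma act_indexM g h x : act_index g (act_index h x) = act_index (g * h)%g x.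
Proof. by rewrite /act_index mulgA. Qed.

Lemma act_index1 x : act_index 1%g x = x.
Proof. by case: x => a n; rewrite /act_index mul1g. Qed.

Lemma rk_shiftM g h phi : rk_shift g (rk_shift h phi) = rk_shift (g * h)%g phi.
Proof.
by apply: rk_ext => x; rewrite /= /shift_fun act_indexM -invgM.
Qed.

Lemma rk_shift1 phi : rk_shift 1%g phi = phi.
Proof. by apply: rk_ext => x; rewrite /= /shift_fun invg1 act_index1. Qed.

(** The displacement M o T_(g^-1) - M of the mean, which is the base point
of the affine hyperplane. *)
Definition cocycle_fun g : G * nat -> R :=
  fun x => M (element (act_index g^-1%g x)) - M (element x).

Lemma comb_cocycle_fun g l : comb (cocycle_fun g) l =
  M (translate g^-1%g (function_of l)) - M (function_of l).
Proof.
rewrite combB -(comb_act_comb (fun x => M (element x))) !mean_function_of.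
by rewrite function_of_act.
Qed.

Lemma cocycle_bounded g : cocycle_fun g \in rk_bounded K.
Proof.
have [C gC] := mean_translate_le M g^-1%g.
apply/asboolP; exists C; apply: rk_le_of_sqr => [|l].
  exact: quasi_invariance_bound_ge0 gC.
rewrite comb_cocycle_fun kform_cov.
apply: le_trans (variance_translate_le (function_of_bc l) gC).
rewrite lerDr; apply: variance_ge0; apply: bc_translate; exact: function_of_bc.
Qed.

Definition cocycle g : H := RKHS (cocycle_bounded g).

Lemma cocycle1 : cocycle 1%g = 0.
Proof. by apply: rk_ext => x; rewrite /= /cocycle_fun invg1 act_index1 subrr. Qed.

Lemma cocycleM g h : cocycle (g * h)%g = rk_shift g (cocycle h) + cocycle g.
Proof.
apply: rk_ext => x; rewrite rk_addE /= /shift_fun /cocycle_fun.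
by rewrite act_indexM -invgM addrA subrK.
Qed.

Definition affine_act g phi : H := rk_shift g phi + cocycle g.

Lemma affine_act_left : left_action affine_act.
Proof.
split=> [phi|g h phi]; first by rewrite /affine_act rk_shift1 cocycle1 addr0.
by rewrite /affine_act raddfD/= rk_shiftM cocycleM addrA.
Qed.

Lemma rk_shift_bounded_operator g : bounded_operator (rk_shift g).
Proof.
have [C gC] := mean_translate_le M g^-1%g.
by exists (Num.sqrt C) => phi; exact: rk_shift_le.
Qed.

Lemma affine_act_affine g : affine_transformation (affine_act g).
Proof.
exists (rk_shift g), (rk_shift g^-1%g), (cocycle g); split => //.
- exact: rk_shift_bounded_operator.
- exact: rk_shift_bounded_operator.
- by move=> phi; rewrite /= rk_shiftM mulVg rk_shift1.
- by move=> phi; rewrite /= rk_shiftM mulgV rk_shift1.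
Qed.

End CovarianceKernel.

Section MeanEstimates.
Context {R : realType} {G : topologicalGroupType}.
Variable (M : quasi_invariant_mean R G).
Implicit Types (f : G -> R) (g h : G).

Definition almost_invariant g (e : R) := forall p,
  bounded_continuous p -> (forall z, 0 <= p z) ->
  `|M (translate g p) - M p| <= e * M p.

Lemma almost_invariant_inv_near (e : R) : 0 < e ->
  \forall h \near (1%g : G), almost_invariant h^-1%g e.
Proof.
move=> e0.
exact: (near1_inv (P := fun h => almost_invariant h e) (mean_translate_near M e0)).
Qed.

(** Shifting one factor of a covariance by a constant changes nothing
once the other one is centered. *)
Lemma mean_mul_centered f f' (t : R) : bounded_continuous f ->
    bounded_continuous f' ->
  M (fun x => (f x - t) * centered M f' x) = covariance M f f'.
Proof.
move=> fb fb'; rewrite /centered.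
rewrite (@eq_mean _ _ M _ (fun x => (f x * f' x - M f' * f x)
  - (t * f' x - t * M f'))); last by move=> x; ring.
have b1 := bcM fb fb'; have b2 := bcZ (M f') fb; have b3 := bcZ t fb'.
have b4 := @bc_cst R G (t * M f').
rewrite (meanB M (bcB b1 b2) (bcB b3 b4)) (meanB M b1 b2) (meanB M b3 b4).
by rewrite (meanZ M _ fb) (meanZ M _ fb') mean_cst /covariance; ring.
Qed.

Lemma mean_centered f : bounded_continuous f -> M (centered M f) = 0.
Proof. by move=> fb; rewrite /centered (meanB M fb (bc_cst _)) mean_cst subrr. Qed.

(** The displacement of the mean under an almost invariant translation
has norm at most [e], in the form of the supremum that defines the norm: polarize
the product of the constant [e] with the centered function. *)
Lemma mean_translate_diff_le (e : R) g f : 0 < e -> almost_invariant g e ->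
    bounded_continuous f ->
  2 * (M (translate g f) - M f) - covariance M f f <= e ^+ 2.
Proof.
move=> e0 ge fb; have cb := bc_centered M fb.
have := mean_mul_translate_le (bc_cst e) cb ge.
rewrite -covarianceE// mean_cst.
have -> : M (translate g (fun x => e * centered M f x)) =
    e * (M (translate g f) - M f).
  have tb := bc_translate g fb.
  rewrite -[X in _ - X](mean_cst M) -(meanB M tb (bc_cst _)).
  by rewrite -(meanZ M _ (bcB tb (bc_cst _))).
rewrite (meanZ M e cb) mean_centered// mulr0 subr0 => h.
rewrite lerBlDr -(ler_pM2l (x := 2 * e)) ?mulr_gt0//; lra.
Qed.

(** Strong continuity on kernel functions. With u and u' the centered
functions of f and f', the difference of covariances is the mean of
T_(g^-1) (T_g u * u') - T_g u * u', small by almost invariance, plus the mean of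
(T_g u - u) * u', small by uniform continuity. *)
Lemma covariance_translate_diff_le (e d B : R) g f f' : 0 < e ->
    almost_invariant g^-1%g e ->
    bounded_continuous f -> bounded_continuous f' ->
    (forall x, `|centered M f x| <= B) ->
    (forall x, `|translate g f x - f x| <= d) ->
  2 * (covariance M (translate g^-1%g f') f - covariance M f' f)
    - covariance M f' f' <= 2 * e ^+ 2 * B ^+ 2 + 2 * d ^+ 2.
Proof.
move=> e0 ge fb fb' fB fd.
pose u := centered M f; pose u' := centered M f'.
have ub : bounded_continuous u by exact: bc_centered.
have u'b : bounded_continuous u' by exact: bc_centered.
pose a := translate g u; have ab : bounded_continuous a by exact: bc_translate.
have tb' := bc_translate g^-1%g fb'.
rewrite -(mean_mul_centered (M f') tb' fb) -(mean_mul_centered (M f') fb' fb).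
rewrite (covarianceE M fb' fb').
(* The factor 2 e balances the two squares produced by polarization, so that
only half of the variance of f' is used up. *)
pose e2a := fun x => 2 * e * a x.
have e2ab : bounded_continuous e2a by exact: bcZ.
have := mean_mul_translate_le e2ab u'b ge.
have aub := bcM ab u'b.
rewrite (@eq_mean _ _ M (fun x => e2a x * u' x) (fun x => 2 * e * (a x * u' x)));
  last by move=> x; rewrite /e2a; ring.
rewrite (meanZ M _ aub).
have -> : M (translate g^-1%g (fun x => e2a x * u' x))
    = 2 * e * M (fun x => (translate g^-1%g f' x - M f') * u x).
  rewrite -(meanZ M); last by apply: bcM => //; apply: bcB => //; exact: bc_cst.
  apply: eq_mean => x; rewrite /e2a /a /translate invgK mulKg /u' /centered /u.
  ring.
have a2 : M (fun x => e2a x * e2a x) <= 4 * e ^+ 2 * B ^+ 2.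
  rewrite -[leRHS](mean_cst M); apply: mean_le; [exact: bcM|exact: bc_cst|].
  move=> x; rewrite /e2a /a.
  have : (translate g u x) ^+ 2 <= B ^+ 2.
    rewrite -[leLHS]real_normK ?num_real// ler_pXn2r ?nnegrE//; first exact: fB.
    exact: le_trans (fB 1%g).
  by have := sqr_ge0 e; nra.
(* The other half pays for the product with T_g u - u, by
2 r s <= 2 r^2 + s^2 / 2. *)
have c2 : 2 * (M (fun x => a x * u' x) - M (fun x => u' x * u x)) <=
    2 * d ^+ 2 + 2^-1 * M (fun x => u' x * u' x).
  have uu' := bcM u'b ub; have u'u' := bcM u'b u'b.
  rewrite -(meanB M aub uu') -(meanZ M _ (bcB aub uu')).
  rewrite -(mean_cst M (2 * d ^+ 2)) -(meanZ M _ u'u').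
  rewrite -(meanD M (bc_cst _) (bcZ _ u'u')).
  apply: mean_le.
  - by apply: bcZ; apply: bcB.
  - by apply: bcD; [exact: bc_cst|exact: bcZ].
  move=> x; have -> : a x * u' x - u' x * u x = (translate g f x - f x) * u' x.
    by rewrite /a /u /translate /centered; ring.
  have : (translate g f x - f x) ^+ 2 <= d ^+ 2.
    rewrite -[leLHS]real_normK ?num_real// ler_pXn2r ?nnegrE//.
    exact: le_trans (fd 1%g).
  move: (translate g f x - f x) (u' x) => r s h.
  by have := sqr_ge0 (2 * r - s); nra.
move: a2 c2; rewrite -/u -/u'.
set A := M (fun x => e2a x * e2a x); set P := M (fun x => a x * u' x).
set Q := M (fun x => (f' x - M f') * u x).
set V := M (fun x => u' x * u' x).
set T := M (fun x => (_ - _) * u x).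
move=> hA hP h.
have {}h : 2 * (T - P) <= 2 * e ^+ 2 * B ^+ 2 + V / 2.
  rewrite -(ler_pM2l (x := 4 * e)) ?mulr_gt0//; nra.
lra.
Qed.

End MeanEstimates.

Section ActionContinuity.
Context {R : realType} {G : topologicalGroupType}.
Variables (M : quasi_invariant_mean R G) (chi : nat -> G -> R).
Hypothesis chi_bc : forall n, bounded_continuous (chi n).
Hypothesis chi_luc : forall n, left_uniformly_continuous (chi n).
Local Notation K := (covariance_kernel M chi_bc).
Local Notation H := (rkhs K).

Lemma cocycle_le (e : R) g : 0 < e -> almost_invariant M g^-1%g e ->
  `|cocycle M chi_bc g| <= e.
Proof.
move=> e0 ge; apply: rk_norm_le (ltW e0) _ => l.
rewrite (comb_cocycle_fun M chi_bc g l) kform_cov.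
by apply: mean_translate_diff_le => //; exact: function_of_bc.
Qed.

Lemma rk_shift_kernel_comb_le (e d B : R) g l : 0 < e ->
    almost_invariant M g^-1%g e ->
    (forall x, `|centered M (function_of chi l) x| <= B) ->
    (forall x, `|translate g (function_of chi l) x - function_of chi l x| <= d) ->
  `|rk_shift g (kernel_comb K l) - kernel_comb K l| ^+ 2
     <= 2 * e ^+ 2 * B ^+ 2 + 2 * d ^+ 2.
Proof.
move=> e0 ge hB hd; rewrite -rk_energyE; apply: rk_energy_min => l'.
rewrite (combB (rk_shift g (kernel_comb K l)) (kernel_comb K l)).
rewrite (_ : comb (rk_shift g _) l' = kform K (act_comb g^-1%g l') l);
  last by rewrite -comb_kernel_comb comb_act_comb.
rewrite comb_kernel_comb !kform_cov.
rewrite function_of_act.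
by apply: covariance_translate_diff_le => //; exact: function_of_bc.
Qed.

Lemma affine_act_continuous :
  continuous (fun p : G * H => affine_act p.1 p.2).
Proof.
have actB g (v w : H) : affine_act g v - affine_act g w = rk_shift g (v - w).
  by rewrite /affine_act raddfB/= opprD addrACA subrr addr0.
apply: (jointly_continuous_action (D := range (kernel_comb K))).
- by have [_ h] := affine_act_left M chi_bc; exact: h.
- move=> g; have [C gC] := mean_translate_le M g^-1%g.
  by exists (Num.sqrt C) => v w; rewrite actB; exact: rk_shift_le.
- exists (Num.sqrt 2); apply: filterS (almost_invariant_inv_near M ltr01).
  move=> h hp v w; rewrite actB; apply: rk_shift_le => p pb p0.
  by have := hp p pb p0; rewrite ler_norml => /andP[_]; lra.
- move=> v e e0; have [l hl] := kernel_comb_dense v e0.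
  by exists (kernel_comb K l) => //; exists l.
move=> _ e [l _ <-] e0.
have [_ [B hB]] := bc_centered M (function_of_bc chi_bc l).
have B0 : 0 <= B by exact: le_trans (hB 1%g).
have [e1 e10 e1E] : exists2 e1 : R, 0 < e1 & e1 * (B + 1) = e / 8.
  exists (e / 8 / (B + 1)); first by rewrite !divr_gt0// ltr_wpDl.
  by rewrite divfK// gt_eqF// ltr_wpDl.
have e80 : 0 < e / 8 by rewrite divr_gt0.
near=> h.
have h1 : almost_invariant M h^-1%g e1.
  by near: h; exact: almost_invariant_inv_near.
have h2 : almost_invariant M h^-1%g (e / 8).
  by near: h; exact: almost_invariant_inv_near.
have h3 : forall y, `|translate h (function_of chi l) y - function_of chi l y|
    <= e / 8.
  by near: h; apply: function_of_luc.
have n1 := rk_shift_kernel_comb_le e10 h1 hB h3.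
have n2 := cocycle_le e80 h2.
have {}n1 : `|rk_shift h (kernel_comb K l) - kernel_comb K l| <= e / 2.
  apply: le_of_sqr; last by rewrite divr_ge0// ltW.
  apply: le_trans n1 _.
  have hb : (e1 * B) ^+ 2 <= (e / 8) ^+ 2.
    by rewrite ler_pXn2r ?nnegrE ?mulr_ge0 ?(ltW e10) ?(ltW e0)//; lra.
  rewrite exprMn in hb; have := sqr_ge0 e; nra.
rewrite /affine_act addrAC.
apply: le_lt_trans (ler_normD _ _) _; lra.
Unshelve. all: by end_near. Qed.

(** By uniform continuity of [chi n], the translates of [chi n] by a dense
sequence are dense, for the uniform norm, among all its translates. *)
Lemma affine_act_separable (s : nat -> G) : dense (range s) ->
  separable_space H.
Proof.
move=> sd.
pose idx (n : nat) : G * nat :=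
  if (unpickle n : option (nat * nat)) is Some (i, j) then (s i, j)
  else (1%g, 0%N).
apply: (rkhs_separable (s := idx)) => [[g n]] e e0.
pose d := Num.sqrt e / 2.
have d0 : 0 < d by rewrite divr_gt0// sqrtr_gt0.
have dE : d ^+ 2 = e / 4 by rewrite exprMn sqr_sqrtr ?ltW//; field.
have hl := luc_translate g (chi_luc n).
have /nbhs_interior := near1_divr g (hl d d0).
set A := interior _ => gA.
have [||z [Az [i _ siE]]] := sd A.
- by exists g; exact: nbhs_singleton.
- exact: open_interior.
rewrite -{z}siE in Az; have {Az}hA := interior_subset Az.
exists (pickle (i, n)).
rewrite /idx pickleK.
have eE : element chi (s i, n) = translate (s i * g^-1)%g (element chi (g, n)).
  by rewrite /element translateM /= mulgVK.
rewrite /= -/(element chi (g, n)) -eE in hA.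
set x := (g, n); set y := (s i, n).
rewrite /= /cov /covariance.
have xb : bounded_continuous (element chi x) by exact: element_bc.
have yb : bounded_continuous (element chi y) by exact: element_bc.
have b1 := bcM xb xb; have b2 := bcM xb yb; have b3 := bcM yb yb.
have hM : M (fun z => element chi x z * element chi x z)
   - 2 * M (fun z => element chi x z * element chi y z)
   + M (fun z => element chi y z * element chi y z) <= d ^+ 2.
  rewrite -(meanZ M _ b2) -(meanB M b1 (bcZ _ b2)).
  rewrite -(meanD M (bcB b1 (bcZ _ b2)) b3) -(mean_cst M (d ^+ 2)).
  apply: mean_le.
  - by apply: bcD => //; apply: bcB => //; exact: bcZ.
  - exact: bc_cst.
  move=> z; have hz := hA z.
  have : (element chi y z - element chi x z) ^+ 2 <= d ^+ 2.
    by rewrite -[leLHS]real_normK ?num_real// ler_pXn2r ?nnegrE ?(ltW d0).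
  by nra.
have := sqr_ge0 (M (element chi x) - M (element chi y)); nra.
Qed.

Hypothesis chi01 : forall n x, 0 <= chi n x <= 1.
Hypothesis chi_mean : forall e : R, 0 < e -> exists n, 1 - e < M (chi n).
Hypothesis chi_escape : forall m n, exists g, forall x,
  translate g (chi n) x * chi m x = 0.

(** A translate of [chi n] that is disjoint from [chi m] is at most
1 - chi m, whose mean is small. *)
Lemma mean_sqr_escape n (e : R) : 0 < e -> exists g,
  M (fun x => translate g (chi n) x * translate g (chi n) x) < e.
Proof.
move=> e0; have [m hm] := chi_mean e0; have [g hg] := chi_escape m n.
exists g; have tb := bc_translate g (chi_bc n).
apply: (@le_lt_trans _ _ (1 - M (chi m))); last by lra.
rewrite -[in leRHS](mean1 M) -(meanB M (bc_cst _) (chi_bc m)).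
apply: mean_le; [exact: bcM|by apply: bcB => //; exact: bc_cst|].
move=> x; have /andP[c0 c1] := chi01 n (g^-1 * x)%g.
have /andP[d0 d1] := chi01 m x; have := hg x; rewrite /translate.
by move=> h; nra.
Qed.

(** The functional psi = phi + M takes at the index (1, n) the same value as
its g-translate at (g, n). A bound on the orbit bounds the latter by a multiple
of the seminorm of T_g (chi n), which is arbitrarily small. So phi = - M on every
[chi n]; but the variance of [chi n] tends to 0 and its mean to 1, so phi is not
bounded for the variance. *)
Lemma affine_act_unbounded (phi : H) :
  ~ bounded_set (range (fun g : G => affine_act g phi)).
Proof.
move=> [B0 [_ hB0]].
have [B B_ge0 hB] : exists2 B : R, 0 <= B & forall g, `|affine_act g phi| <= B.
  exists `|B0 + 1| => // g; apply: le_trans (ler_norm _).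
  by apply: (hB0 (B0 + 1)); [rewrite ltrDl|exists g].
have phiE n : phi (1%g, n) = - M (chi n).
  apply/eqP; rewrite -subr_eq0 opprK -sqrf_eq0 eq_le sqr_ge0 andbT.
  apply/ler_addgt0Pr => e e0; rewrite add0r.
  have C0 : 0 < 2 * B ^+ 2 + 2 by rewrite ltr_wpDl// mulr_ge0 ?sqr_ge0.
  have [g hg] := mean_sqr_escape n (divr_gt0 e0 C0).
  have fE : function_of chi [:: (1, (g, n))] = translate g (chi n).
    by apply/funext => z; rewrite /function_of comb1 mul1r.
  have := comb_le_norm (affine_act g phi) [:: (1, (g, n))].
  rewrite comb1 mul1r kform_cov fE rk_addE /= /shift_fun /cocycle_fun.
  rewrite /act_index /= mulVg /element /= translate1.
  have tb := bc_translate g (chi_bc n).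
  have := variance_le_mean_sqr M tb; have := variance_ge0 M tb.
  have hB2 : `|affine_act g phi| ^+ 2 <= B ^+ 2 by rewrite ler_pXn2r ?nnegrE.
  have hc : covariance M (translate g (chi n)) (translate g (chi n))
      + M (translate g (chi n)) ^+ 2
      = M (fun x => translate g (chi n) x * translate g (chi n) x).
    by rewrite /covariance -expr2 subrK.
  move: hc hg; rewrite ltr_pdivlMr//.
  move: (phi _) (M (chi n)) (M (translate g (chi n))) (covariance _ _ _).
  move: hB2 (M _) => + S p c t V; move: (_ ^+ 2) => N hN hc hS V0 hV h.
  have h' : (p + (c - t)) ^+ 2 <= B ^+ 2 * V.
    by apply: le_trans h _; rewrite ler_wpM2r.
  have t0 := sqr_ge0 t; have BB := sqr_ge0 B.
  have s1 : (p + c) ^+ 2 <= 2 * (p + (c - t)) ^+ 2 + 2 * t ^+ 2.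
    by have := sqr_ge0 (p + (c - t) - t); nra.
  by nra.
have e0 : 0 < (2 * (`|phi| ^+ 2 + 1))^-1 :> R.
  by rewrite invr_gt0 mulr_gt0// ltr_wpDl ?sqr_ge0.
have [n hn] := chi_mean e0.
have := comb_le_norm phi [:: (1, (1%g, n))].
have fE : function_of chi [:: (1, (1%g, n))] = chi n.
  by apply/funext => z; rewrite /function_of comb1 mul1r /element translate1.
rewrite comb1 mul1r kform_cov fE phiE sqrrN.
have : M (fun x => chi n x * chi n x) <= M (chi n).
  apply: mean_le => //; first exact: bcM.
  by move=> x; have /andP[? ?] := chi01 n x; nra.
have : M (chi n) <= 1.
  rewrite -(mean1 M); apply: mean_le => //; first exact: bc_cst.
  by move=> x; have /andP[] := chi01 n x.
move: hn; rewrite /covariance.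
have N0 : 0 <= `|phi| ^+ 2 by exact: sqr_ge0.
move: (M (fun x => _)) (M (chi n)) (`|phi| ^+ 2) N0 e0 => S c N N0 e0 hc c1 hS h.
have eE : (2 * (N + 1))^-1 * (2 * (N + 1)) = 1.
  by rewrite mulVf// gt_eqF// mulr_gt0// ltr_wpDl.
move: (2 * (N + 1))^-1 e0 eE hc => e e0 eE hc.
have h1 : c ^+ 2 <= N * (c * (1 - c)).
  by apply: le_trans h _; rewrite ler_wpM2l//; lra.
have c0 : 1 / 2 <= c by nra.
by nra.
Qed.

End ActionContinuity.

Theorem affine_action_of_mean (R : realType) (G : topologicalGroupType)
    (M : quasi_invariant_mean R G) (chi : nat -> G -> R) (s : nat -> G) :
    dense (range s) ->
    (forall n, bounded_continuous (chi n)) ->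
    (forall n, left_uniformly_continuous (chi n)) ->
    (forall n x, 0 <= chi n x <= 1) ->
    (forall e : R, 0 < e -> exists n, 1 - e < M (chi n)) ->
    (forall m n, exists g, forall x, translate g (chi n) x * chi m x = 0) ->
  exists (H : completeNormedModType R) (a : G -> H -> H),
    hilbert_space H /\ separable_space H /\
    left_action a /\
    continuous (fun p : G * H => a p.1 p.2) /\
    (forall g : G, affine_transformation (a g)) /\
    (forall x : H, ~ bounded_set (range (fun g : G => a g x))).
Proof.
move=> sd cb cl c01 cm ce.
exists (rkhs (covariance_kernel M cb)), (@affine_act R G M chi cb).
split; first exact: rkhs_hilbert.
split; first exact: affine_act_separable sd.
split; first exact: affine_act_left.
split; first exact: affine_act_continuous.
split; first exact: affine_act_affine.
exact: affine_act_unbounded.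
Qed.

(** * The theorem *)

Theorem theorem1p3 (R : realType) (G : topologicalGroupType)
    (polishG : polish_space R G) (lcG : locally_compact [set: G])
    (ncG : ~ compact [set: G]) :
  exists (H : completeNormedModType R) (a : G -> H -> H),
    hilbert_space H /\ separable_space H /\
    left_action a /\
    continuous (fun p : G * H => a p.1 p.2) /\
    (forall g : G, affine_transformation (a g)) /\
    (forall x : H, ~ bounded_set (range (fun g : G => a g x))).
Proof.
have [I] := exists_haar polishG lcG.
have [v [vc v0 vC vn vI]] := exists_integrable_weight I polishG lcG.
have [s sd] := dense_sequence polishG.1.
have cut := cutoff polishG lcG.
apply: (affine_action_of_mean (M := weighted_mean vc v0 vC vn vI cut)
  (chi := cutoffs vc v0 vI cut) sd).
- by move=> n; exact/cs_bc/cutoffs_cs.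
- by move=> n; exact/cs_luc/cutoffs_cs.
- exact: cutoffs01.
- exact: weighted_mean_cutoffs.
- exact: cutoffs_escape.
Qed.
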